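(* Let Assumption (SL) (see context) hold with $\delta=\frac{d}{\alpha c}\in(0,1)$, and let $Z_n\stackrel{d}{=}Z_1(\lfloor n\,\cdot\rfloor)/b_n$ be the scaled BGWI processes. Fix any $t>0$ and a sequence $(t_n)$ with $t_n\to t$. Then the law of $Z_n(t_n)$, conditioned on $Z_n$ remaining positive on $[1/n,t_n]$, i.e. on $\{d_{1/n}(Z_n)>t_n\}$, converges weakly to the Linnik law $\nu^t$: $$\lim_{n\to\infty}\mathbb E\left(e^{-\lambda Z_n(t_n)}\,\middle|\,d_{1/n}(Z_n)>t_n\right)=(1+\alpha c\,t\,\lambda^\alpha)^{-1}\qquad\text{for all }\lambda\ge0.$$
   Context: $\mathbb N=\{0,1,2,\dots\}$; $a_n\sim a_n'$ means $a_n/a_n'\to1$. $\mu,\nu$ are probability distributions on $\mathbb N$ (offspring and immigration laws) with $\mu(1)<1$ and $\nu(0)>0$; $f(s)=\sum_{n}s^n\mu(n)$, $g(s)=\sum_n s^n\nu(n)$. Assumption (SL): for $s\in(0,1)$, $f(s)=s+c(1-s)^{1+\alpha}\ell(1-s)$ and $g(s)=1-d(1-s)^\alpha k(1-s)$ for some constants $c,d>0$, $\alpha\in(0,1]$ and functions $\ell,k:(0,1)\to(0,\infty)$ slowly varying at $0$ with $\ell(s)/k(s)\to1$ as $s\to0$. Scaling sequence: $(b_n)$ is a sequence of positive reals, regularly varying with index $1/\alpha$, with $b_n^\alpha\sim n\,\ell(1/b_n)$. BGWI process: $Z_1=(Z_1(k))_{k\in\mathbb N}$ is the Markov chain on $\mathbb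 N$ with $Z_1(0)=0$ in which, given $Z_1(k)$, $Z_1(k+1)$ is the sum of $Z_1(k)$ i.i.d. variables of law $\mu$ plus an independent variable of law $\nu$. For a càdlàg path $w:[0,\infty)\to[0,\infty)$, $d_t(w)=\inf\{s>t:w(s)=0\}$ ($\inf\emptyset=\infty$). Thus $d_{1/n}(Z_n)$ has the law of $\frac1n\inf\{m\ge1:Z_1(m)=0\}$. The Linnik law $\nu^t$ is the probability law on $[0,\infty)$ with Laplace transform $\lambda\mapsto(1+\alpha c\,t\,\lambda^\alpha)^{-1}$. *)

(* Defs.v *)
From HB Require Import structures.
From mathcomp Require Import all_boot all_order all_algebra.
From mathcomp Require Import all_classical all_reals all_analysis.

Set Implicit Arguments.
Unset Strict Implicit.
Unset Printing Implicit Defensive.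

Import Order.TTheory GRing.Theory Num.Theory.
Import numFieldNormedType.Exports.

Local Open Scope classical_set_scope.
Local Open Scope ring_scope.

Definition mass (R : realType) (mu : probability nat R) (n : nat) : R :=
  fine (mu [set n]).

Definition gen_fun (R : realType) (mu : probability nat R) (s : R) : R :=
  limn (series (fun n => s ^+ n * mass mu n)).

Definition slowly_varying_at0 (R : realType) (l : R -> R) : Prop :=
  forall x : R, 0 < x -> l (x * s) / l s @[s --> 0^'+] --> (1 : R).

Definition regularly_varying_seq (R : realType) (rho : R) (b : nat -> R) : Prop :=
  forall x : R, 0 < x ->
    b (Num.truncn (x * n%:R)) / b n @[n --> \oo] --> x `^ rho.

(* [l] and [k] are functions on ]0, 1[; their values elsewhere are irrelevant. *)
Definition assumption_SL (R : realType) (mu nu : probability nat R)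
    (alpha c d : R) (l k : R -> R) : Prop :=
  [/\ 0 < alpha <= 1, 0 < c, 0 < d,
      [/\ (forall s, 0 < s < 1 -> 0 < l s /\ 0 < k s),
          slowly_varying_at0 l,
          slowly_varying_at0 k &
          l s / k s @[s --> 0^'+] --> (1 : R)] &
      forall s, 0 < s < 1 ->
        gen_fun mu s = s + c * (1 - s) `^ (1 + alpha) * l (1 - s) /\
        gen_fun nu s = 1 - d * (1 - s) `^ alpha * k (1 - s)].

Definition scaling_seq (R : realType) (alpha : R) (l : R -> R) (b : nat -> R) :
    Prop :=
  [/\ forall n, 0 < b n,
      regularly_varying_seq alpha^-1 b &
      b n `^ alpha / (n%:R * l (b n)^-1) @[n --> \oo] --> (1 : R)].

Definition conv (R : realType) (p q : nat -> R) (n : nat) : R :=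
  \sum_(i < n.+1) p i * q (n - i)%N.

Fixpoint conv_pow (R : realType) (p : nat -> R) (m : nat) : nat -> R :=
  if m is m'.+1 then conv p (conv_pow p m') else fun n => (n == 0%N)%:R.

(* Given x, the law of the sum of x i.i.d. variables of law [mu] plus an
   independent variable of law [nu]. *)
Definition BGWI_kernel (R : realType) (mu nu : probability nat R) (x : nat) :
    nat -> R :=
  conv (conv_pow (mass mu) x) (mass nu).

(* The transition rule is stated on cylinders, which contains both the Markov
   property and the one-step law. *)
Definition is_BGWI (R : realType) (mu nu : probability nat R)
    d (T : measurableType d) (P : probability T R) (Z : nat -> {RV P >-> nat}) :
    Prop :=
  P [set w | Z 0%N w = 0%N] = 1%E /\
  forall (m : nat) (x : nat -> nat),
    P [set w | forall i, (i <= m.+1)%N -> Z i w = x i] =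
    (P [set w | forall i, (i <= m)%N -> Z i w = x i] *
     (BGWI_kernel mu nu (x m) (x m.+1))%:E)%E.

(* [Num.truncn] is the floor on nonnegative reals; a path indexed by negative
   times is extended by its value at 0. *)
Definition scaled_path (R : realType) (b : nat -> R) (n : nat) (z : nat -> nat) :
    R -> R :=
  fun s => (z (Num.truncn (n%:R * s)))%:R / b n.

Definition next_zero (R : realType) (t : R) (w : R -> R) : \bar R :=
  ereal_inf [set s%:E | s in [set s | t < s /\ w s = 0]].

Definition cond_expect (R : realType) d (T : measurableType d)
    (P : probability T R) (X : T -> R) (A : set T) : R :=
  (\int[P]_(w in A) X w)%R / fine (P A).

Definition is_linnik (R : realType) (alpha c t : R)
    (L : probability (measurableTypeR R) R) : Prop :=
  L [set x : R | 0 <= x] = 1%E /\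
  forall lam : R, 0 <= lam ->
    (\int[L]_x expR (- (lam * x)))%R = (1 + alpha * c * t * lam `^ alpha)^-1.

(* Weak convergence to [L] of the law of [X n] under [P n] conditioned on
   [A n]; the probability space may change with n. *)
Definition cond_law_cvg (R : realType) (d : nat -> measure_display)
    (T : forall n, measurableType (d n)) (P : forall n, probability (T n) R)
    (X : forall n, T n -> R) (A : forall n, set (T n))
    (L : probability (measurableTypeR R) R) : Prop :=
  forall h : R -> R, continuous h -> (exists M, forall x, `|h x| <= M) ->
    cond_expect (P n) (h \o X n) (A n) @[n --> \oo] -->
    (\int[L]_x h x)%R.

(* Main.v *)
Require Import Defs.
From HB Require Import structures.
From mathcomp Require Import all_boot all_order all_algebra.
From mathcomp Require Import all_classical all_reals all_analysis.
From mathcomp Require Import measurable_realfun ring lra zify.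

Set Implicit Arguments.
Unset Strict Implicit.
Unset Printing Implicit Defensive.

Import Order.TTheory GRing.Theory Num.Theory.
Import numFieldNormedType.Exports.

Local Open Scope classical_set_scope.
Local Open Scope ring_scope.

(* Idea. Let f, g be the generating functions of mu, nu, let
   u n = P(Z n = 0) = prod_(i < n) g(f^i 0), let r n be the probability of no return to 0 up
   to time n, and let h_N n = E[(f^N 0)^(Z n); no return to 0 up to time n]. Splitting at the
   last visit to 0 gives, for the convolution of sequences, u * r = 1 and
   (u * h_N) n = u (n + N) / u N.

   Since f is convex, the rate A(s) = (f(1 - s) - (1 - s)) / s satisfies
   1 / A(q (n + 1)) - 1 / A(q n) --> alpha along q n = 1 - f^n 0, hence
   n (1 - u (n + 1) / u n) --> delta, that is (n + 1) u (n + 1) = (n + 1 - delta) u n + e n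
   with e = o(u). Multiplication by n is a derivation for the convolution, so this
   near-differential equation transfers exactly to r and h_N:
     (n + 1) r (n + 1) = delta (r 0 + ... + r n) - (r * r * e) n,
     (N + n + 1) h_N (n + 1) = N r (n + 1) + (r * e (N + .) / u N) n - (r * h_N * e) n.
   The error terms are o(r 0 + ... + r n) because u * r * r = 1 * r and r --> 0, whence
   h_N n / r n - N / (N + n) --> 0 as n, N --> oo, with no Tauberian theorem. Finally
   exp(- lam / b n) lies between f^N 0 and f^(N + 1) 0 with
   N / n --> 1 / (alpha c lam^alpha). *)

Local Notation conv := Defs.conv.

(** * Formal power series *)

(** Regular variation of generating functions controls [r] and [h_N] only on average, whereas a
    conditional law needs their quotient at each single index. The recurrence for [u] is pointwise,
    and a derivation keeps it so. In the version for [h_N] the multiples of delta cancel, which is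
    why [d] does not enter the limit law: up to errors, (N + n + 1) h_N (n + 1) is N r (n + 1).

    Delta acts through its two bounds. Since delta < 1, the series of [u] diverges and [r] tends to
    0. Since delta > 0, n r n is comparable with the partial sums of [r], so that an error
    negligible against these sums is negligible against n r n.

    Slow variation is only used at fixed dilation factors. Convexity supplies the rest: it makes the
    rate A monotone, which gives the uniformity needed at moving factors, and slopes of chords do
    the work of derivatives. *)

Definition fps (R : realType) : Type := nat -> R.

Section PowerSeries.
Variable R : realType.
Implicit Types p q r : nat -> R.

Let trunc_poly n p : {poly R} := \poly_(i < n.+1) p i.

(** A coefficient of degree at most [n] of a product depends only on the truncations at [n], so the
    ring laws of [conv] are inherited from [{poly R}]. *)
Let coef_truncM p q m n : (m <= n)%N ->
  (trunc_poly n p * trunc_poly n q)`_m = conv p q m.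
Proof.
move=> mn; rewrite coefM; apply: eq_bigr => i _.
rewrite !coef_poly !ltnS (leq_trans (leq_ord i) mn).
by rewrite (leq_trans (leq_subr _ _) mn).
Qed.

Lemma convC : commutative (@conv R).
Proof.
move=> p q; apply/funext => n.
by rewrite -(@coef_truncM p q n n) // mulrC coef_truncM.
Qed.

Lemma convA : associative (@conv R).
Proof.
move=> p q r; apply/funext => n.
transitivity ((trunc_poly n p * trunc_poly n q * trunc_poly n r)`_n).
  rewrite -mulrA coefM; apply: eq_bigr => i _.
  by rewrite coef_truncM ?leq_subr// coef_poly ltn_ord.
rewrite coefM; apply: eq_bigr => i _.
by rewrite coef_truncM ?leq_ord// coef_poly ltnS leq_subr.
Qed.

Lemma conv1 : left_id (fun n => (n == 0%N)%:R) (@conv R).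
Proof.
move=> p; apply/funext => n; rewrite /conv big_ord_recl /= mul1r subn0.
by rewrite big1 ?addr0// => i _; rewrite mul0r.
Qed.

Lemma convDl : left_distributive (@conv R) (fun p q n => p n + q n).
Proof.
move=> p q r; apply/funext => n; rewrite /conv -big_split /=.
by apply: eq_bigr => i _; rewrite mulrDl.
Qed.

Let fps_addA : associative (fun p q n => p n + q n).
Proof. by move=> p q r; apply/funext => n; rewrite addrA. Qed.
Let fps_addC : commutative (fun p q n => p n + q n).
Proof. by move=> p q; apply/funext => n; rewrite addrC. Qed.
Let fps_add0 : left_id (fun=> 0) (fun p q n => p n + q n).
Proof. by move=> p; apply/funext => n; rewrite add0r. Qed.
Let fps_addN : left_inverse (fun=> 0) (fun p n => - p n) (fun p q n => p n + q n).
Proof. by move=> p; apply/funext => n; rewrite addNr. Qed.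
Let fps_oner_neq0 : (fun n => (n == 0%N)%:R) != (fun=> 0) :> fps R.
Proof. by apply/eqP => /(congr1 (@^~ 0%N))/eqP; rewrite oner_eq0. Qed.

(** The alias [fps] carries the instances so that [*] denotes the Cauchy product and not the
    pointwise product of functions. *)
HB.instance Definition _ := gen_eqMixin (fps R).
HB.instance Definition _ := gen_choiceMixin (fps R).
HB.instance Definition _ :=
  GRing.isZmodule.Build (fps R) fps_addA fps_addC fps_add0 fps_addN.
HB.instance Definition _ :=
  GRing.Zmodule_isComNzRing.Build (fps R) convA convC conv1 convDl fps_oner_neq0.
End PowerSeries.

Section PowerSeriesOps.
Variable R : realType.
Implicit Types p q r : fps R.

Lemma fpsM p q n : (p * q) n = \sum_(i < n.+1) p i * q (n - i)%N.
Proof. by []. Qed.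

Lemma fpsD p q n : (p + q) n = p n + q n. Proof. by []. Qed.

Lemma fpsN p n : (- p) n = - p n. Proof. by []. Qed.

Definition fpsC (a : R) : fps R := fun n => if n == 0%N then a else 0.
Definition fpsX : fps R := fun n => (n == 1%N)%:R.
(** The series of $1/(1-X)$; multiplication by it takes partial sums. *)
Definition fps_geo : fps R := fun=> 1.
(** The Euler operator $X\,d/dX$, a derivation that acts diagonally on coefficients. *)
Definition fps_theta p : fps R := fun n => n%:R * p n.

Lemma fpsCM a p n : (fpsC a * p) n = a * p n.
Proof.
rewrite fpsM big_ord_recl /fpsC /= subn0 big1 ?addr0// => i _.
by rewrite mul0r.
Qed.

Lemma fpsC1 : fpsC 1 = 1 :> fps R.
Proof. by apply/funext => -[]. Qed.

Lemma fpsCB a b : fpsC (a - b) = fpsC a - fpsC b.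
Proof.
by apply/funext => -[|n]; rewrite fpsD fpsN /fpsC /= ?subr0.
Qed.

Lemma fpsXM0 p : (fpsX * p) 0%N = 0.
Proof. by rewrite fpsM big_ord1 mul0r. Qed.

Lemma fpsXMS p n : (fpsX * p) n.+1 = p n.
Proof.
rewrite fpsM 2!big_ord_recl /fpsX /= mul0r mul1r add0r subSS subn0.
by rewrite big1 ?addr0// => i _; rewrite mul0r.
Qed.

Lemma fps_geoM p n : (fps_geo * p) n = \sum_(i < n.+1) p i.
Proof. by rewrite mulrC fpsM; apply: eq_bigr => i _; rewrite mulr1. Qed.

Lemma fps_thetaM p q :
  fps_theta (p * q) = fps_theta p * q + p * fps_theta q.
Proof.
apply/funext => n; rewrite fpsD !fpsM /fps_theta fpsM -big_split mulr_sumr.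
apply: eq_bigr => i _ /=; have -> : n%:R = i%:R + (n - i)%:R :> R.
  by rewrite -natrD subnKC// leq_ord.
by ring.
Qed.

(** Coefficient [n] of the product isolates [q n] from its predecessors. The identities below are
    checked after multiplication by [u], then [u] is cancelled. *)
Lemma fps_mulfI p q r : p 0%N = 1 -> p * q = p * r -> q = r.
Proof.
move=> p0 pqr; apply/funext => n; elim/ltn_ind: n => n IH.
have := congr1 (@^~ n) pqr; rewrite /= !fpsM !big_ord_recl /= p0 !mul1r subn0.
have -> : \sum_(i < n) p (lift ord0 i) * q (n - lift ord0 i)%N =
          \sum_(i < n) p (lift ord0 i) * r (n - lift ord0 i)%N.
  by apply: eq_bigr => i _; rewrite IH// lift0; have := ltn_ord i; lia.
by move/addIr.
Qed.

(** The recurrence says that $(N+\theta)w$ increases by $(1-\delta)w_n+e_n$ from $n$ to $n+1$, that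
    is $(1-X)(N+\theta)w=N+X((1-\delta)w+e)$; division by $1-X$ gives the claim. The constant $N$
    comes from $w_0=1$. *)
Lemma fps_recurrence (w e : fps R) (N delta : R) : w 0%N = 1 ->
    (forall n, (n.+1%:R + N) * w n.+1 = (n.+1%:R + N - delta) * w n + e n) ->
  fpsC N * w + fps_theta w =
  fpsC N * fps_geo + fpsX * ((1 - fpsC delta) * fps_geo * w + fps_geo * e).
Proof.
move=> w0 wS; apply/funext => n; rewrite !fpsD !fpsCM /fps_theta.
elim: n => [|n IH]; first by rewrite fpsXM0 w0 mul0r mulr1.
have step : (fpsX * ((1 - fpsC delta) * fps_geo * w + fps_geo * e)) n.+1 =
    (fpsX * ((1 - fpsC delta) * fps_geo * w + fps_geo * e)) n +
    ((1 - delta) * w n + e n).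
  rewrite fpsXMS -fpsC1 -fpsCB -!mulrA fpsD fpsCM !fps_geoM.
  case: n {IH} => [|n]; first by rewrite fpsXM0 !big_ord1 add0r.
  rewrite fpsXMS fpsD fpsCM !fps_geoM !(@big_ord_recr _ _ _ n.+1)/=.
  by ring.
rewrite step addrA -IH /= /fps_geo.
have := wS n; rewrite -natr1 => wn.
by lra.
Qed.

(** * Differential identities for the renewal equation *)

Section Identities.
Variables (u r e : fps R) (delta : R).
Hypotheses (u0 : u 0%N = 1) (ur : u * r = fps_geo).
Hypothesis uS :
  forall n, n.+1%:R * u n.+1 = (n.+1%:R - delta) * u n + e n.

Let theta_u : fps_theta u =
  fpsX * ((1 - fpsC delta) * fps_geo * u + fps_geo * e).
Proof.
have H : forall n, (n.+1%:R + 0) * u n.+1 = (n.+1%:R + 0 - delta) * u n + e n.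
  by move=> n; rewrite addr0.
have := fps_recurrence u0 H.
have C0 p : fpsC 0 * p = 0 by apply/funext => n; rewrite fpsCM mul0r.
by rewrite !C0 !add0r.
Qed.

Let theta_geo : fps_theta fps_geo = fpsX * (fps_geo * fps_geo).
Proof.
apply/funext => -[|n]; rewrite /fps_theta ?fpsXM0 ?mul0r// fpsXMS fps_geoM.
by rewrite /fps_geo mulr1 sumr_const card_ord.
Qed.

(** Leibniz' rule on $ur=1/(1-X)$: of the term $X/(1-X)^2$ the fraction $1-\delta$ is taken by
    $r\,\theta u$, which leaves $\delta$. *)
Lemma renewal_tail_identity :
  fps_theta r = fpsX * (fpsC delta * fps_geo * r - r * r * e).
Proof.
apply: (fps_mulfI u0).
have : fps_theta (u * r) = fpsX * (fps_geo * fps_geo) by rewrite ur theta_geo.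
rewrite fps_thetaM theta_u -ur => H.
rewrite -[LHS](addrK ((fpsX * ((1 - fpsC delta) * (u * r) * u + u * r * e)) * r)).
by rewrite [X in X - _]addrC H; ring.
Qed.

(** The recurrences of [u] and [w] have the same coefficient $1-\delta$, so its multiples cancel
    between $\theta(uh)$ and $h\,\theta u$. *)
Lemma killed_identity (w h eps : fps R) (N : R) : w 0%N = 1 -> u * h = w ->
    (forall n, (n.+1%:R + N) * w n.+1 = (n.+1%:R + N - delta) * w n + eps n) ->
  fpsC N * h + fps_theta h = fpsC N * r + fpsX * (r * eps - r * h * e).
Proof.
move=> w0 uh wS; apply: (fps_mulfI u0).
have := fps_recurrence w0 wS; rewrite -uh fps_thetaM theta_u -ur => H.
transitivity (fpsC N * (u * h) +
    ((fpsX * ((1 - fpsC delta) * (u * r) * u + u * r * e)) * h +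
      u * fps_theta h) -
    (fpsX * ((1 - fpsC delta) * (u * r) * u + u * r * e)) * h); first by ring.
by rewrite H; ring.
Qed.

End Identities.
End PowerSeriesOps.

(** * Renewal asymptotics *)

Section RenewalAsymptotics.
Variables (R : realType) (u r : fps R) (delta : R).
Hypotheses (u_gt0 : forall n, 0 < u n) (u0 : u 0%N = 1).
Hypothesis u_noninc : forall n, u n.+1 <= u n.
Hypothesis delta01 : 0 < delta < 1.
Hypothesis u_ratio : n.+1%:R * (1 - u n.+1 / u n) @[n --> \oo] --> delta.
Hypotheses (r_ge0 : forall n, 0 <= r n) (r_noninc : forall n, r n.+1 <= r n).
Hypothesis ur : u * r = fps_geo R.

Let e : fps R := fun n => n.+1%:R * u n.+1 - (n.+1%:R - delta) * u n.
Let ae : fps R := fun n => `|e n|.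

Let uS n : n.+1%:R * u n.+1 = (n.+1%:R - delta) * u n + e n.
Proof. by rewrite /e; ring. Qed.

Let e_small (eps : R) : 0 < eps ->
  exists M, forall n, (M <= n)%N -> `|e n| <= eps * u n.
Proof.
move=> eps0; move/cvgrPdist_le/(_ _ eps0) : u_ratio => [M _ HM].
exists M => n Mn; have := HM n Mn => /= Hn.
have -> : e n = (delta - n.+1%:R * (1 - u n.+1 / u n)) * u n.
  by rewrite /e; field; exact: lt0r_neq0.
by rewrite normrM (gtr0_norm (u_gt0 n)) ler_pM2r.
Qed.

Let r_le (m n : nat) : (m <= n)%N -> r n <= r m.
Proof. by move/subnK <-; elim: (n - m)%N => // j; exact/le_trans/r_noninc. Qed.

Let r0 : r 0%N = 1.
Proof.
by have := congr1 (@^~ 0%N) ur; rewrite fpsM big_ord1 u0 mul1r.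
Qed.

Let Rs n := (fps_geo R * r) n.

Let RsE n : Rs n = \sum_(i < n.+1) r i. Proof. exact: fps_geoM. Qed.

Let Rs_mono m n : (m <= n)%N -> Rs m <= Rs n.
Proof.
move/subnK <-; elim: (n - m)%N => // j IH.
by rewrite addSn (le_trans IH)// !RsE [leRHS]big_ord_recr /= lerDl.
Qed.

Let Rs_ge1 n : 1 <= Rs n.
Proof. by rewrite RsE big_ord_recl r0 lerDl sumr_ge0. Qed.

(* [k * u k] is eventually nondecreasing, so [u] dominates the harmonic series. *)
Let u_sum_unbounded (C : R) : exists n, C <= \sum_(i < n) u i.
Proof.
have [d0 d1] := andP delta01.
have [M HM] : exists M, forall n, (M <= n)%N -> `|e n| <= (1 - delta) * u n.
  by apply: e_small; rewrite subr_gt0.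
have mono n : (M <= n)%N -> n%:R * u n <= n.+1%:R * u n.+1.
  move=> Mn; rewrite uS.
  have := HM n Mn; rewrite ler_norml => /andP[+ _].
  by rewrite -natr1; lra.
have [c c0 Hc] : exists2 c, 0 < c & forall n, (M < n)%N -> c / n%:R <= u n.
  exists (M.+1%:R * u M.+1); first by rewrite mulr_gt0.
  move=> n Mn; rewrite ler_pdivrMr ?ltr0n; last by case: n Mn.
  rewrite [leRHS]mulrC.
  elim: n Mn => // n IH; rewrite ltnS leq_eqVlt => /predU1P[->//|Mn].
  by rewrite (le_trans (IH Mn))// mono// ltnW.
apply: contrapT => noB.
have sumC n : \sum_(i < n) u i <= C.
  by rewrite leNgt; apply/negP => lt; apply: noB; exists n; exact: ltW.
have hB j : series (@harmonic R) (M + j)%N <=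
    series (@harmonic R) M + c^-1 * \sum_(i < (M + j).+1) u i.
  elim: j => [|j IH].
    by rewrite addn0 lerDl mulr_ge0 ?invr_ge0 ?(ltW c0)// sumr_ge0// => i _; apply/ltW.
  rewrite addnS seriesSr big_ord_recr /= mulrDr addrA lerD// /harmonic/=.
  by rewrite ler_pdivlMl// Hc// ltnS leq_addr.
apply: (@dvg_harmonic R); apply: nondecreasing_is_cvgn.
  by apply: nondecreasing_series => i _ _; exact: harmonic_ge0.
exists (series (@harmonic R) M + c^-1 * C) => _ [n _ <-].
apply: (@le_trans _ _ (series (@harmonic R) (M + n)%N)).
  by apply: nondecreasing_series; [move=> i _ _; exact: harmonic_ge0|exact: leq_addl].
apply: (le_trans (hB n)); rewrite lerD2l ler_wpM2l// invr_ge0 ltW//.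
Qed.

(** As [r] is nonincreasing, [r n] times the sum of [u i] over [i <= n] is at most [(u * r) n = 1],
    and the sum of [u] is unbounded. *)
Let r_cvg0 (eps : R) : 0 < eps -> exists M, forall n, (M <= n)%N -> r n <= eps.
Proof.
move=> eps0; have [[|M] HM] := u_sum_unbounded eps^-1.
  by move: HM; rewrite big_ord0 leNgt invr_gt0 eps0.
exists M => n Mn.
have := congr1 (@^~ n) ur; rewrite fpsM /= => urn.
suff : eps^-1 * r n <= 1 by rewrite ler_pdivrMl// mulr1.
apply: (@le_trans _ _ (\sum_(i < n.+1) u i * r n)).
  rewrite -mulr_suml ler_wpM2r//; apply: (le_trans HM).
  rewrite -(subnK Mn) -addnS addnC big_split_ord/= lerDl sumr_ge0// => i _.
  exact/ltW.
rewrite -[leRHS]/(fps_geo R n) -urn; apply: ler_sum => i _.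
by rewrite ler_wpM2l ?(ltW (u_gt0 _))// r_le// leq_subr.
Qed.

(** One of [i] and [j - i] is at least [j./2], so one factor of [r i * r (j - i)] is at most
    [r (j./2)]. *)
Let rr_le j : (r * r) j <= 2 * r (j./2) * Rs j.
Proof.
have -> : 2 * r (j./2) * Rs j = \sum_(i < j.+1) r (j./2) * (r i + r (j - i)%N).
  rewrite -mulr_sumr big_split/= -RsE.
  rewrite -[X in _ + X](_ : Rs j = _); first by ring.
  by rewrite /Rs fpsM; apply: eq_bigr => i _; rewrite mul1r.
rewrite fpsM; apply: ler_sum => i _; rewrite mulrDr.
have [hi|hi] := leqP (j./2) i.
  by rewrite ler_wpDl ?mulr_ge0// ler_wpM2r// r_le.
rewrite ler_wpDr ?mulr_ge0// mulrC ler_wpM2r// r_le//.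
by move: hi; have := odd_double_half j; lia.
Qed.

Let rr_small (eps : R) : 0 < eps ->
  exists M, forall j, (M <= j)%N -> (r * r) j <= eps * Rs j.
Proof.
move=> eps0; have [M HM] := @r_cvg0 (eps / 2) (divr_gt0 eps0 (ltr0Sn R 1)).
exists M.*2 => j Mj; rewrite (le_trans (rr_le j))// ler_wpM2r//.
  by rewrite (le_trans ler01).
rewrite -ler_pdivlMl// mulrC HM//.
by move: Mj; have := odd_double_half j; lia.
Qed.

(** [ae] is at most [eps / 2 * u] plus finitely many terms. The first part contributes
    [eps / 2 * Rs], because [u * r * r = fps_geo * r]; the second is a finite combination of shifts
    of [r * r], to which [rr_small] applies. *)
Let rre_small (eps : R) : 0 < eps ->
  exists M, forall n, (M <= n)%N -> (r * r * ae) n <= eps * Rs n.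
Proof.
move=> eps0.
have eps20 : 0 < eps / 2 by rewrite divr_gt0.
have [K HK] := e_small eps20.
(* The summand 1 only keeps [C] positive for the division below. *)
pose C := 1 + \sum_(i < K) `|e i|.
have C0 : 0 < C by rewrite ltr_pwDl// sumr_ge0.
have [M HM] := rr_small (divr_gt0 eps20 C0).
have eB i : ae i <= eps / 2 * u i + (if (i < K)%N then ae i else 0).
  rewrite /ae; case: ltnP => iK; first by rewrite lerDr mulr_ge0 ?ltW.
  by rewrite addr0 HK.
exists (M + K)%N => n Mn.
have rr0 j : 0 <= (r * r) j by rewrite fpsM sumr_ge0// => i _; rewrite mulr_ge0.
rewrite mulrC fpsM.
apply: (@le_trans _ _ (\sum_(i < n.+1) (eps / 2 * (u i * (r * r) (n - i)%N) +
    (if (i < K)%N then ae i * (r * r) (n - i)%N else 0)))).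
  apply: ler_sum => i _; apply: (le_trans (ler_wpM2r (rr0 _) (eB i))).
  by rewrite mulrDl mulrA; case: ifP; rewrite ?mul0r.
rewrite big_split/= -mulr_sumr -fpsM mulrA ur [X in _ <= X * _](splitr eps) mulrDl.
rewrite lerD2l -big_mkcond/=.
apply: (@le_trans _ _ (\sum_(i < n.+1 | (i < K)%N) ae i * (eps / 2 / C * Rs n))).
  apply: ler_sum => i iK; rewrite ler_wpM2l ?normr_ge0//; apply: (le_trans (HM _ _)); first lia.
  by rewrite ler_wpM2l ?(ltW (divr_gt0 _ _))// Rs_mono// leq_subr.
rewrite -mulr_suml.
have -> : \sum_(i < n.+1 | (i < K)%N) ae i = \sum_(i < K) ae i.
  by rewrite (big_ord_widen_cond n.+1 xpredT (fun i => ae i))//; lia.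
rewrite mulrA ler_wpM2r ?(le_trans ler01)// mulrCA ler_piMr ?(ltW eps20)//.
by rewrite ler_pdivrMr// mul1r /C lerDr.
Qed.

Lemma renewal_tail_ratio : n.+1%:R * r n.+1 / (fps_geo R * r) n @[n --> \oo] --> delta.
Proof.
apply/cvgrPdist_le => eps eps0; have [M HM] := rre_small eps0.
exists M => // n Mn /=.
have := congr1 (@^~ n.+1) (renewal_tail_identity u0 ur uS).
rewrite /= /fps_theta fpsXMS -mulrA fpsD fpsN fpsCM => ->.
have R0 : 0 < (fps_geo R * r) n by rewrite (lt_le_trans ltr01) ?Rs_ge1.
rewrite [X in `|X|](_ : _ = (r * r * e) n / (fps_geo R * r) n); last first.
  by field; rewrite lt0r_neq0.
rewrite normrM normfV (gtr0_norm R0) ler_pdivrMr//.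
apply: le_trans (HM n Mn); rewrite !fpsM; apply: le_trans (ler_norm_sum _ _ _) _.
apply: ler_sum => i _; rewrite normrM ger0_norm// fpsM sumr_ge0// => j _.
by rewrite mulr_ge0.
Qed.

(** The threshold precedes [h], since [h] will vary with [N]; the error bounds use only
    [0 <= h <= r] and the renewal equation of [h]. *)
Lemma renewal_killed_ratio (eps : R) : 0 < eps -> exists M, forall (N m : nat) (h : fps R),
  (M <= N)%N -> (M <= m)%N -> (forall k, 0 <= h k <= r k) ->
  (forall k, (u * h) k = u (k + N)%N / u N) ->
  0 < r m /\ `|h m / r m - N%:R / (N%:R + m%:R)| <= eps.
Proof.
move=> eps0; have [d0 d1] := andP delta01.
(* Two errors of size at most [eta * Rs m] will be compared with
   [m.+1 * r m.+1 >= delta / 2 * Rs m], and [2 * eta = eps * (delta / 2)]. *)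
pose eta := eps * delta / 4; have eta0 : 0 < eta by rewrite divr_gt0 ?mulr_gt0.
have [M1 H1] := e_small eta0; have [M2 H2] := rre_small eta0.
have d20 : 0 < delta / 2 by rewrite divr_gt0.
have /cvgrPdist_le/(_ _ d20)[M3 _ H3] := renewal_tail_ratio.
exists (maxn M1 (maxn M2 M3)).+1 => N [//|m] h /ltnW.
rewrite ltnS !geq_max => /and3P[M1N _ _] /and3P[_ M2m M3m] hr uh.
have R0 : 0 < Rs m by rewrite (lt_le_trans ltr01) ?Rs_ge1.
have rm : delta / 2 * Rs m <= m.+1%:R * r m.+1.
  have /= := H3 m M3m; rewrite ler_norml => /andP[_ H].
  by rewrite -ler_pdivlMr//; move: H; rewrite -/(Rs m); lra.
have r_gt0 : 0 < r m.+1.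
  rewrite -(pmulr_rgt0 _ (ltr0Sn R m)).
  by apply: lt_le_trans rm; rewrite mulr_gt0.
split => //.
pose w : fps R := fun k => u (k + N)%N / u N.
pose ee : fps R := fun k => e (k + N)%N / u N.
have uN := lt0r_neq0 (u_gt0 N).
have w0 : w 0%N = 1 by rewrite /w add0n divff.
have wS n : (n.+1%:R + N%:R) * w n.+1 = (n.+1%:R + N%:R - delta) * w n + ee n.
  have := uS (n + N)%N; rewrite -addSn natrD => H.
  by rewrite /w /ee mulrA H; field.
have uhw : u * h = w by apply/funext.
have := congr1 (@^~ m.+1) (killed_identity u0 ur uS w0 uhw wS).
rewrite /= !fpsD !fpsCM /fps_theta fpsXMS fpsD fpsN => key.
(* Since [u] is nonincreasing, [|e (k + N)| <= eta * u (k + N) <= eta * u N]: for large [N] every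
   coefficient of [ee] is at most [eta]. *)
have B1 : `|(r * ee) m| <= eta * Rs m.
  rewrite RsE mulr_sumr fpsM (le_trans (ler_norm_sum _ _ _))//.
  apply: ler_sum => i _; rewrite normrM ger0_norm// mulrC ler_wpM2r//.
  rewrite normrM normfV (gtr0_norm (u_gt0 N)) ler_pdivrMr//.
  have u_le j : u (j + N)%N <= u N.
    by elim: j => // j; apply: le_trans; exact: u_noninc.
  apply: le_trans (H1 _ (leq_trans M1N (leq_addl _ _))) _.
  by rewrite ler_wpM2l ?(ltW eta0).
(* The bound [h <= r] reduces this error to the one of [r] itself. *)
have B2 : `|(r * h * e) m| <= eta * Rs m.
  apply: le_trans (H2 m M2m).
  rewrite !fpsM (le_trans (ler_norm_sum _ _ _))//; apply: ler_sum => i _.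
  rewrite normrM ler_wpM2r ?normr_ge0// !fpsM (le_trans (ler_norm_sum _ _ _))//.
  apply: ler_sum => j _; have /andP[h0 hj] := hr (i - j)%N.
  by rewrite normrM !ger0_norm// ler_wpM2l.
have Nm0 : 0 < N%:R + m.+1%:R :> R by rewrite ltr_wpDl.
have -> : h m.+1 / r m.+1 - N%:R / (N%:R + m.+1%:R) =
    ((r * ee) m - (r * h * e) m) / ((N%:R + m.+1%:R) * r m.+1).
  have -> : (r * ee) m - (r * h * e) m =
      (N%:R + m.+1%:R) * h m.+1 - N%:R * r m.+1 by rewrite mulrDl; lra.
  by field; rewrite !lt0r_neq0.
rewrite normrM normfV (gtr0_norm (mulr_gt0 Nm0 r_gt0)) ler_pdivrMr ?mulr_gt0//.
apply: le_trans (ler_normB _ _) _; apply: le_trans (lerD B1 B2) _.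
have : 0 <= N%:R * r m.+1 by rewrite mulr_ge0.
move=> Nr; apply: (@le_trans _ _ (eps * (m.+1%:R * r m.+1))).
  apply: le_trans (ler_wpM2l (ltW eps0) rm).
  by rewrite /eta le_eqVlt; apply/orP; left; apply/eqP; field.
by rewrite ler_wpM2l ?(ltW eps0)// mulrDl lerDr.
Qed.

End RenewalAsymptotics.

(** * Generating functions *)

Section GeneratingFunction.
Variables (R : realType) (mu : probability nat R).

Lemma mass_ge0 n : 0 <= mass mu n. Proof. exact: fine_ge0. Qed.

Lemma massE n : (mass mu n)%:E = mu [set n].
Proof. by rewrite fineK// fin_num_measure. Qed.

Lemma sum_mass : (\sum_(n <oo) (mass mu n)%:E = 1)%E.
Proof.
rewrite -(@probability_setT _ _ _ mu).
have -> : [set: nat] = \bigcup_n [set n].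
  by apply/seteqP; split=> // n _; exists n.
rewrite measure_semi_bigcup//; last by move=> i j _ _ [x [/= -> ->]].
by apply: eq_eseriesr => n _; rewrite massE.
Qed.

Let term (s : R) n := s ^+ n * mass mu n.

Let term_ge0 s n : 0 <= s -> 0 <= term s n.
Proof. by move=> s0; rewrite mulr_ge0 ?exprn_ge0// mass_ge0. Qed.

Let cvg_term s : 0 <= s <= 1 -> series (term s) @ \oo --> gen_fun mu s.
Proof.
move=> /andP[s0 s1]; apply: nnseries_is_cvg => [n|]; first exact: term_ge0 s0.
apply: (@le_lt_trans _ _ 1%E); last exact: ltry.
rewrite -sum_mass; apply: lee_nneseries => n *; rewrite lee_fin ?term_ge0//.
by rewrite /term ler_piMl ?mass_ge0// exprn_ile1.
Qed.

Lemma gen_fun_nneseries s : 0 <= s <= 1 ->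
  (\sum_(n <oo) (s ^+ n * mass mu n)%:E = (gen_fun mu s)%:E)%E.
Proof.
move=> s01; rewrite -EFin_lim; last by apply/cvg_ex; exists (gen_fun mu s); exact: cvg_term.
by apply/congr_lim/funext => n /=; rewrite /series/= sumEFin.
Qed.

Lemma gen_fun1 : gen_fun mu 1 = 1.
Proof.
apply: EFin_inj; rewrite -gen_fun_nneseries ?ler01 ?lexx// -sum_mass.
by apply: eq_eseriesr => n _; rewrite expr1n mul1r.
Qed.

Lemma gen_fun0 : gen_fun mu 0 = mass mu 0%N.
Proof.
apply: cvg_lim => //; apply: cvg_near_cst; exists 1%N => // -[//|n] _ /=.
rewrite /series/= big_nat_recl// expr0 mul1r big1 ?addr0// => i _.
by rewrite expr0n mul0r.
Qed.

Lemma gen_fun_le x y : 0 <= x -> x <= y -> y <= 1 -> gen_fun mu x <= gen_fun mu y.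
Proof.
move=> x0 xy y1.
apply: (ler_cvg_to (cvg_term _) (cvg_term _)).
- by rewrite x0 (le_trans xy).
- by rewrite (le_trans x0 xy).
apply: nearW => n; apply: ler_sum => i _.
by rewrite ler_wpM2r ?mass_ge0// lerXn2r// nnegrE (le_trans x0).
Qed.

Lemma gen_fun_itv s : 0 <= s <= 1 -> 0 <= gen_fun mu s <= 1.
Proof.
move=> /andP[s0 s1]; rewrite -[X in _ && (_ <= X)]gen_fun1 gen_fun_le// andbT.
by rewrite (le_trans (mass_ge0 0))// -gen_fun0 gen_fun_le.
Qed.

(** The induction step leaves the defect $(1-t)t(x-y)(x^n-y^n)$, nonnegative because powers are
    monotone on the half-line. *)
Let expr_convex (t x y : R) n : 0 <= t <= 1 -> 0 <= x -> 0 <= y ->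
  ((1 - t) * x + t * y) ^+ n <= (1 - t) * x ^+ n + t * y ^+ n.
Proof.
move=> /andP[t0 t1] x0 y0; elim: n => [|n IH]; first by rewrite !expr0; lra.
rewrite exprS.
have : 0 <= (1 - t) * x + t * y by rewrite addr_ge0// mulr_ge0// subr_ge0.
move=> /ler_wpM2l/(_ _ _ IH) /le_trans; apply; rewrite -subr_ge0.
have -> : (1 - t) * x ^+ n.+1 + t * y ^+ n.+1 -
    ((1 - t) * x + t * y) * ((1 - t) * x ^+ n + t * y ^+ n) =
    (1 - t) * t * ((x - y) * (x ^+ n - y ^+ n)) by rewrite !exprS; ring.
apply: mulr_ge0; first by rewrite mulr_ge0// subr_ge0.
have [xy|/ltW xy] := leP x y.
  by rewrite mulr_le0// subr_le0// lerXn2r.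
by rewrite mulr_ge0// subr_ge0// lerXn2r.
Qed.

Lemma gen_fun_convex t x y : 0 <= t <= 1 -> 0 <= x <= 1 -> 0 <= y <= 1 ->
  gen_fun mu ((1 - t) * x + t * y) <= (1 - t) * gen_fun mu x + t * gen_fun mu y.
Proof.
move=> t01 x01 y01.
move: (t01) (x01) (y01) => /andP[t0 t1] /andP[x0 x1] /andP[y0 y1].
have z01 : 0 <= (1 - t) * x + t * y <= 1.
  by rewrite addr_ge0 ?mulr_ge0 ?subr_ge0//=; nra.
have c2 : (1 - t) * series (term x) n + t * series (term y) n @[n --> \oo] -->
    (1 - t) * gen_fun mu x + t * gen_fun mu y.
  by apply: cvgD; (apply: cvgM; first exact: cvg_cst); exact: cvg_term.
apply: (ler_cvg_to (cvg_term z01) c2).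
apply: nearW => n /=; rewrite /series/= !mulr_sumr -big_split/=.
apply: ler_sum => i _; rewrite /term !mulrA -mulrDl ler_wpM2r ?mass_ge0//.
exact: expr_convex.
Qed.

End GeneratingFunction.

(** * Generating series of convolutions and of the transition kernel *)

Section GeneratingSeries.
Variable R : realType.
Implicit Types (p q : nat -> R) (s : R).
Local Open Scope ereal_scope.

Definition gen_series p s : \bar R := \sum_(n <oo) (s ^+ n * p n)%:E.

(** The Cauchy product is written as a double series over all pairs, with zeros for [i > n]; its
    terms are nonnegative extended reals, so the order of summation may be exchanged without any
    convergence assumption. *)
Lemma gen_series_conv p q s : (0 <= s)%R ->
    (forall n, 0 <= p n)%R -> (forall n, 0 <= q n)%R ->
  gen_series (conv p q) s = \sum_(i <oo) ((s ^+ i * p i)%:E * gen_series q s).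
Proof.
move=> s0 p0 q0.
pose a n i : \bar R :=
  if (i <= n)%N then ((s ^+ i * p i) * (s ^+ (n - i) * q (n - i)%N))%:E else 0.
have a0 n i : 0 <= a n i.
  by rewrite /a; case: ifP => // _; rewrite lee_fin !mulr_ge0// exprn_ge0.
transitivity (\sum_(n <oo) \sum_(i <oo) a n i).
  apply: eq_eseriesr => n _.
  rewrite (nneseries_split _ n.+1)// add0n [X in _ + X]eseries0 ?adde0; last first.
    by move=> i ni _; rewrite /a leqNgt ni.
  rewrite /conv mulr_sumr -sumEFin big_mkord; apply: eq_bigr => i _.
  rewrite /a leq_ord; congr (_%:E).
  have -> : (s ^+ n = s ^+ i * s ^+ (n - i))%R by rewrite -exprD subnKC// leq_ord.
  by ring.
rewrite nneseries_interchange//; apply: eq_eseriesr => i _.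
rewrite (nneseries_split _ i)// add0n big1_seq ?add0e; last first.
  by move=> n; rewrite mem_index_iota /a => /andP[_ /andP[_ ni]]; rewrite leqNgt ni.
rewrite -nneseries_addn// /gen_series -nneseriesZl; last first.
  by move=> n _; rewrite lee_fin mulr_ge0// exprn_ge0.
by apply: eq_eseriesr => n _; rewrite /a leq_addl addnK EFinM.
Qed.

Lemma conv_ge0 p q : (forall n, 0 <= p n)%R -> (forall n, 0 <= q n)%R ->
  forall n, (0 <= conv p q n)%R.
Proof. by move=> p0 q0 n; apply: sumr_ge0 => i _; rewrite mulr_ge0. Qed.

Lemma conv_pow_ge0 p m : (forall n, 0 <= p n)%R -> forall n, (0 <= conv_pow p m n)%R.
Proof. by move=> p0; elim: m => [|m IH] n /=; [exact: ler0n|exact: conv_ge0]. Qed.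

Variables mu nu : probability nat R.

Lemma BGWI_kernel_ge0 x y : (0 <= BGWI_kernel mu nu x y)%R.
Proof.
by apply: conv_ge0 => n; [apply: conv_pow_ge0 => ?|]; exact: mass_ge0.
Qed.

Lemma gen_series_BGWI_kernel s x : (0 <= s <= 1)%R ->
  gen_series (BGWI_kernel mu nu x) s = (gen_fun mu s ^+ x * gen_fun nu s)%:E.
Proof.
move=> s01; have /andP[s0 s1] := s01.
have convE p (a : R) (q : nat -> R) (b : R) : (forall n, 0 <= p n)%R -> (forall n, 0 <= q n)%R ->
    gen_series p s = a%:E -> gen_series q s = b%:E ->
    gen_series (conv p q) s = (a * b)%:E.
  move=> p0 q0 pa qb; rewrite gen_series_conv// qb.
  under eq_eseriesr do rewrite muleC.
  rewrite nneseriesZl; last by move=> n _; rewrite lee_fin mulr_ge0// exprn_ge0.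
  by rewrite -/(gen_series p s) pa muleC -EFinM.
have m0 := @mass_ge0 R.
rewrite /BGWI_kernel (@convE _ (gen_fun mu s ^+ x)%R _ (gen_fun nu s))//.
- by apply: conv_pow_ge0 => ?.
- elim: x => [|x IH] /=.
    rewrite /gen_series (nneseries_split _ 1)//; last first.
      by move=> n _; rewrite lee_fin mulr_ge0// exprn_ge0.
    rewrite big_nat1 [X in _ + X]eseries0 ?adde0 ?expr0 ?mulr1// => -[|n] _ _ //.
    by rewrite mulr0.
  rewrite exprS; apply: convE => //.
    by apply: conv_pow_ge0 => ?.
  exact: gen_fun_nneseries.
- exact: gen_fun_nneseries.
Qed.

End GeneratingSeries.

(** * The process killed at 0 *)

(* [killed f g m s] is E[s^(Z m); Z i <> 0 for 0 < i <= m]: the kernel maps s^y to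
   g s * (f s)^x, and killing at 0 subtracts the value of this at s = 0. *)
Fixpoint killed (R : realType) (f g : R -> R) (m : nat) (s : R) : R :=
  if m is m'.+1 then g s * killed f g m' (f s) - g 0 * killed f g m' (f 0) else 1.

Section KilledProcess.
Variables (R : realType) (mu nu : probability nat R).
Variables (disp : measure_display) (T : measurableType disp) (P : probability T R).
Variable Z : nat -> {RV P >-> nat}.
Hypothesis hZ : is_BGWI mu nu Z.
Local Open Scope ereal_scope.

Let measurable_forall (I : nat -> Prop) (S : nat -> set nat) :
  measurable [set w | forall i, I i -> S i (Z i w)].
Proof.
have -> : [set w | forall i, I i -> S i (Z i w)] =
    \bigcap_(i in I) (Z i @^-1` (S i)) by [].
apply: bigcap_measurableType => i _.
by rewrite -[X in measurable X]setTI; exact: measurable_funPT.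
Qed.

Let measurable_at k y : measurable [set w | Z k w = y].
Proof.
have -> : [set w | Z k w = y] = Z k @^-1` [set y] by [].
by rewrite -[X in measurable X]setTI; exact: measurable_funPT.
Qed.

(** Mixed cylinders: times before [j] are only constrained to [S], the later ones are pinned to [x].
    The transition rule is the case [j = 0]; releasing one more time is a sum over its values. *)
Let path_event (S : nat -> set nat) (x : nat -> nat) (j m : nat) : set T :=
  [set w | forall i, (i <= m)%N -> (if (i < j)%N then S i else [set x i]) (Z i w)].

Let measurable_path_event S x j m : measurable (path_event S x j m).
Proof. exact: (measurable_forall (fun i => i <= m)%N (fun i => if (i < j)%N then S i else [set x i])). Qed.

Let path_event_sum S x j m : (j <= m)%N ->
  P (path_event S x j.+1 m) = \sum_(y <oo)
    (if y \in S j then P (path_event S (fun i => if i == j then y else x i) j m) else 0).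
Proof.
move=> jm.
pose F y := if y \in S j then path_event S (fun i => if i == j then y else x i) j m else set0.
have -> : path_event S x j.+1 m = \bigcup_y F y.
  apply/seteqP; split => [w Hw|w [y _]].
    have Sj : S j (Z j w) by have := Hw j jm; rewrite ltnSn.
    exists (Z j w) => //; rewrite /F mem_set// => i im.
    have := Hw i im; rewrite ltnS [(i <= j)%N]leq_eqVlt.
    by case: eqP => [->|_] /=; [rewrite ltnn|].
  rewrite /F; case: ifPn => [/set_mem Sy Hw i im|//].
  have := Hw i im; rewrite ltnS [(i <= j)%N]leq_eqVlt.
  by case: eqP => [->|_] /=; [rewrite ltnn => ->|].
rewrite measure_semi_bigcup.
- by apply: eq_eseriesr => y _; rewrite /F; case: ifP => // _; rewrite measure0.
- by move=> y; rewrite /F; case: ifP.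
- move=> y z _ _ [w []]; rewrite /F; case: ifP => // _ Hy; case: ifP => // _ Hz.
  by have := Hy j jm; have := Hz j jm; rewrite ltnn eqxx /= => -> ->.
- by apply: bigcup_measurable => y _; rewrite /F; case: ifP.
Qed.

(** The bound on [j] keeps time [m] pinned, so the kernel factor is the same in every summand when
    earlier times are released. *)
Let path_event_step S j m x : (j <= m)%N ->
  P (path_event S x j m.+1) =
  P (path_event S x j m) * (BGWI_kernel mu nu (x m) (x m.+1))%:E.
Proof.
elim: j x => [|j IH] x jm; first by have [_ /(_ m x)] := hZ.
rewrite !path_event_sum ?(ltnW jm)//; last exact: leqW (ltnW jm).
rewrite muleC -nneseriesZl; last by move=> y _; case: ifP.
apply: eq_eseriesr => y _; case: ifP => _; last by rewrite mule0.
by rewrite IH ?(ltnW jm)// (gtn_eqF jm) (gtn_eqF (leqW jm)) muleC.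
Qed.

Definition no_return (m : nat) : set T :=
  [set w | forall i, (0 < i <= m)%N -> Z i w != 0%N].

Lemma measurable_no_return m : measurable (no_return m).
Proof. exact: (measurable_forall (fun i => 0 < i <= m)%N (fun i => [set z | z != 0%N])). Qed.

Let killed_mass m y := P (no_return m `&` [set w | Z m w = y]).

Let measurable_slice m y : measurable (no_return m `&` [set w | Z m w = y]).
Proof.
by apply: measurableI; [exact: measurable_no_return|exact: measurable_at].
Qed.

Let transition m x y :
  P (no_return m `&` [set w | Z m w = x] `&` [set w | Z m.+1 w = y]) =
  killed_mass m x * (BGWI_kernel mu nu x y)%:E.
Proof.
(* Time 0 is left free, because the chain starts at 0. If [0 < m] and [x = 0] the event is empty,
   and both sides vanish. *)
pose S i : set nat := [set z | (0 < i)%N -> z != 0%N].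
pose xx i := if (i <= m)%N then x else y.
have [/andP[m0 /eqP x0]|m0x] := boolP ((0 < m)%N && (x == 0%N)).
  have E : no_return m `&` [set w | Z m w = x] = set0.
    rewrite -subset0 => w [] /(_ m); rewrite m0 leqnn => /(_ isT) /eqP + /=.
    by rewrite x0.
  by rewrite /killed_mass E set0I measure0 mul0e.
have E : no_return m `&` [set w | Z m w = x] = path_event S xx m m.
  apply/seteqP; split => w.
    move=> [nr Zx] i im; case: ifPn => [im' i0|]; first by rewrite nr// i0.
    by rewrite -leqNgt => mi; rewrite (_ : i = m) ?/xx ?leqnn//; apply/eqP; rewrite eqn_leq im.
  move=> Hw; split; last by have := Hw m (leqnn m); rewrite ltnn /xx leqnn.
  move=> i /andP[i0 im]; have := Hw i im; case: ifPn => [_ /(_ i0)//|].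
  rewrite -leqNgt /xx im /= => mi ->.
  by apply: contra m0x => /eqP ->; rewrite (leq_trans i0 im) eqxx.
have E' : no_return m `&` [set w | Z m w = x] `&` [set w | Z m.+1 w = y] = path_event S xx m m.+1.
  rewrite E; apply/seteqP; split => w.
    move=> [Hw Zy] i; rewrite leq_eqVlt => /predU1P[->|]; last exact: Hw.
    by rewrite ltnNge leqnSn /xx ltnn.
  move=> Hw; split; last by have := Hw m.+1 (leqnn _); rewrite ltnNge leqnSn /xx ltnn.
  by move=> i im; apply: Hw; exact: leqW.
by rewrite E' path_event_step// /killed_mass E /xx leqnn ltnn.
Qed.

(** For [y = 0] the left side is 0 while the right side need not be; this is the mass that the
    recursion of [killed] subtracts. *)
Let killed_massS m y : y != 0%N -> killed_mass m.+1 y =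
  \sum_(x <oo) killed_mass m x * (BGWI_kernel mu nu x y)%:E.
Proof.
move=> y0.
have E : no_return m.+1 `&` [set w | Z m.+1 w = y] =
    \bigcup_x (no_return m `&` [set w | Z m w = x] `&` [set w | Z m.+1 w = y]).
  apply/seteqP; split => [w [nr Zy]|w [x _ [[nr Zx] Zy]]].
    exists (Z m w) => //; split => //; split => // i /andP[i0 im].
    by apply: nr; rewrite i0 leqW.
  split => // i /andP[i0]; rewrite leq_eqVlt => /predU1P[->|im]; first by rewrite Zy.
  by apply: nr; rewrite i0.
have mF x : measurable (no_return m `&` [set w | Z m w = x] `&` [set w | Z m.+1 w = y]).
  by apply: measurableI => //; exact: measurable_at.
rewrite /killed_mass E measure_semi_bigcup//.
- by apply: eq_eseriesr => x _; exact: transition.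
- by move=> i j _ _ [w [[[_ Zi] _] [[_ Zj] _]]]; rewrite -Zi -Zj.
- exact: bigcup_measurable.
Qed.

Let killed_mass_fin m y : killed_mass m y \is a fin_num.
Proof. exact: fin_num_measure. Qed.

Let gen_killed m s := \sum_(y <oo) (s ^+ y)%:E * killed_mass m y.

Let gen_killedE m (s : R) : (0 <= s <= 1)%R ->
  gen_killed m s = (killed (gen_fun mu) (gen_fun nu) m s)%:E.
Proof.
elim: m s => [|m IH] s s01; have /andP[s0 s1] := s01.
  rewrite /gen_killed (nneseries_split _ 1)//; last first.
    by move=> y _; rewrite mule_ge0// lee_fin exprn_ge0.
  have E0 : no_return 0 = setT.
    by apply/seteqP; split => // w _ [].
  have P0 := hZ.1.
  rewrite big_nat1 expr0 mul1e /killed_mass E0 setTI P0 eseries0 ?adde0//.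
  move=> y y0 _; rewrite setTI; suff -> : P [set w | Z 0 w = y] = 0 by rewrite mule0.
  have mZ := measurable_at 0.
  apply/eqP; rewrite eq_le measure_ge0 andbT.
  have <- : P (~` [set w | Z 0 w = 0%N]) = 0 by rewrite probability_setC// P0 subee.
  by apply: le_measure; rewrite ?inE//; [exact: measurableC|move=> w /= -> ?; subst y].
(* The mass at time [m.+1] before killing at that time; [full 0] is its generating series evaluated
   at 0. *)
pose full y := \sum_(x <oo) killed_mass m x * (BGWI_kernel mu nu x y)%:E.
have K0 := BGWI_kernel_ge0 mu nu.
have full0 y : 0 <= full y.
  by apply: nneseries_ge0 => x _ _; rewrite mule_ge0// lee_fin.
have fullE t : (0 <= t <= 1)%R -> \sum_(y <oo) (t ^+ y)%:E * full y =
    (gen_fun nu t * killed (gen_fun mu) (gen_fun nu) m (gen_fun mu t))%:E.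
  move=> t01; have /andP[t0 _] := t01.
  have t0y y : 0 <= (t ^+ y)%:E by rewrite lee_fin exprn_ge0.
  under eq_eseriesr => y _.
    rewrite /full -nneseriesZl; last by move=> x _; rewrite mule_ge0// lee_fin.
    over.
  rewrite nneseries_interchange; last by move=> *; rewrite !mule_ge0// lee_fin.
  transitivity (\sum_(x <oo) ((gen_fun nu t)%:E * ((gen_fun mu t ^+ x)%:E * killed_mass m x))).
    apply: eq_eseriesr => x _.
    rewrite muleA -EFinM mulrC -(gen_series_BGWI_kernel mu nu x t01) /gen_series muleC.
    rewrite -(fineK (killed_mass_fin m x)) -nneseriesZl; last first.
      by move=> y _; rewrite lee_fin mulr_ge0// exprn_ge0.
    by apply: eq_eseriesr => y _; rewrite EFinM muleCA.
  have /andP[f0 f1] := gen_fun_itv mu t01.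
  rewrite nneseriesZl; last by move=> x _; rewrite mule_ge0// lee_fin exprn_ge0.
  by rewrite -/(gen_killed m (gen_fun mu t)) IH ?f0// EFinM.
have := fullE s s01; rewrite (nneseries_split _ 1)//; last first.
  by move=> y _; rewrite mule_ge0// lee_fin exprn_ge0.
rewrite big_nat1 expr0 mul1e.
have -> : full 0%N = (gen_fun nu 0 * killed (gen_fun mu) (gen_fun nu) m (gen_fun mu 0))%:E.
  rewrite -fullE ?lexx ?ler01// (nneseries_split _ 1)//; last first.
    by move=> y _; rewrite mule_ge0// lee_fin exprn_ge0.
  rewrite big_nat1 expr0 mul1e [X in _ + X]eseries0 ?adde0// => -[//|y] _ _.
  by rewrite expr0n mul0e.
move=> H.
rewrite /gen_killed (nneseries_split _ 1)//; last first.
  by move=> y _; rewrite mule_ge0// lee_fin exprn_ge0.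
rewrite big_nat1; have -> : killed_mass m.+1 0%N = 0.
  rewrite /killed_mass (_ : _ `&` _ = set0) ?measure0// -subset0 => w [].
  by move=> /(_ m.+1); rewrite leqnn => /(_ isT) /eqP + /=.
rewrite mule0 add0e add0n.
have -> : \sum_(1 <= y <oo) (s ^+ y)%:E * killed_mass m.+1 y =
    \sum_(1 <= y <oo) (s ^+ y)%:E * full y.
  rewrite [LHS]eseries_cond [RHS]eseries_cond; apply: eq_eseriesr => y /andP[_ y0].
  by rewrite killed_massS -?lt0n.
move: H; rewrite add0n addeC => H.
by rewrite -[LHS](@addeK _ (gen_fun nu 0 *
  killed (gen_fun mu) (gen_fun nu) m (gen_fun mu 0))%:E)// H.
Qed.

Lemma integral_no_return m (s : R) : (0 <= s <= 1)%R ->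
  \int[P]_(w in no_return m) (s ^+ Z m w)%:E =
  (killed (gen_fun mu) (gen_fun nu) m s)%:E.
Proof.
move=> s01; have /andP[s0 s1] := s01.
have E : no_return m = \bigcup_y (no_return m `&` [set w | Z m w = y]).
  by apply/seteqP; split => [w nr|w [y _ []]//]; exists (Z m w).
rewrite {1}E ge0_integral_bigcup//.
- rewrite -gen_killedE//; apply: eq_eseriesr => y _.
  rewrite -(integral_cst P (measurable_slice m y)).
  by apply: eq_integral => w; rewrite inE => -[_ /= ->].
- apply/measurable_EFinP; apply: (@measurable_funTS _ _ _ _ _ (fun w => s ^+ Z m w)%R).
  apply: (@measurableT_comp _ _ _ _ _ _ (fun n : nat => s ^+ n)%R) => //.
- by move=> w _; rewrite lee_fin exprn_ge0.
- by move=> i j _ _ [w [[_ <-] [_ <-]]].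
Qed.

Lemma probability_no_return m :
  P (no_return m) = (killed (gen_fun mu) (gen_fun nu) m 1)%:E.
Proof.
rewrite -integral_no_return ?ler01 ?lexx//.
under eq_integral do rewrite expr1n.
by rewrite integral_cst ?mul1e//; exact: measurable_no_return.
Qed.

Let measurable_expr_at (s : R) m : measurable_fun (no_return m) (fun w => (s ^+ Z m w)%:E).
Proof.
apply/measurable_EFinP; apply: (@measurable_funTS _ _ _ _ _ (fun w => s ^+ Z m w)%R).
exact: (@measurableT_comp _ _ _ _ _ _ (fun n : nat => s ^+ n)%R).
Qed.

(** The recursion of [killed] is a difference and does not display sign or monotonicity; both come
    from its meaning as an integral of [s ^+ Z m]. *)
Lemma killed_le m (s s' : R) : (0 <= s)%R -> (s <= s')%R -> (s' <= 1)%R ->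
  (0 <= killed (gen_fun mu) (gen_fun nu) m s <=
    killed (gen_fun mu) (gen_fun nu) m s')%R.
Proof.
move=> s0 ss s1; have s'0 := le_trans s0 ss; have s1' := le_trans ss s1.
have I := @integral_no_return m.
rewrite -!lee_fin -!I ?s0 ?s'0//; apply/andP; split.
  by apply: integral_ge0 => w _; rewrite lee_fin exprn_ge0.
apply: ge0_le_integral => //.
- exact: measurable_no_return.
- by move=> w _; rewrite lee_fin exprn_ge0.
- by move=> w _; rewrite lee_fin lerXn2r// nnegrE.
Qed.

Lemma killed1_noninc m :
  (killed (gen_fun mu) (gen_fun nu) m.+1 1 <= killed (gen_fun mu) (gen_fun nu) m 1)%R.
Proof.
rewrite -lee_fin -!probability_no_return; apply: le_measure.
- by rewrite inE; exact: measurable_no_return.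
- by rewrite inE; exact: measurable_no_return.
- by move=> w nr i /andP[i0 im]; apply: nr; rewrite i0 leqW.
Qed.

End KilledProcess.

(** * Decomposition at the last visit to 0 *)

Section KilledRenewal.
Variables (R : realType) (f g : R -> R).

(* [immigration_prod m s] is E[s^(Z m)]. *)
Definition immigration_prod (m : nat) (s : R) : R := \prod_(i < m) g (iter i f s).

Lemma immigration_prodS m s : immigration_prod m.+1 s = g s * immigration_prod m (f s).
Proof.
rewrite /immigration_prod big_ord_recl; congr (_ * _).
by apply: eq_bigr => i _; rewrite lift0 iterSr.
Qed.

Lemma immigration_prodD m n s :
  immigration_prod (m + n) s = immigration_prod m (iter n f s) * immigration_prod n s.
Proof.
rewrite /immigration_prod addnC big_split_ord/= mulrC; congr (_ * _).
by apply: eq_bigr => i _; rewrite addnC iterD.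
Qed.

(** The sum runs over the time [k] of the last visit to 0, after which the chain starts afresh.
    Algebraically, each summand with [k <= m] unfolds by the recursion of [killed], and the last one
    restores the subtracted term. *)
Lemma killed_renewal m s :
  \sum_(k < m.+1) immigration_prod k 0 * killed f g (m - k) s = immigration_prod m s.
Proof.
elim: m s => [|m IH] s; first by rewrite big_ord1 /immigration_prod !big_ord0 mul1r.
rewrite big_ord_recr/= subnn mulr1.
have -> : \sum_(k < m.+1) immigration_prod k 0 * killed f g (m.+1 - k) s =
    g s * immigration_prod m (f s) - g 0 * immigration_prod m (f 0).
  rewrite -!IH !mulr_sumr -sumrB; apply: eq_bigr => k _.
  by rewrite subSn ?leq_ord//=; ring.
by rewrite !immigration_prodS; ring.
Qed.

End KilledRenewal.

(** * Decay of the survival probability *)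

Lemma cvg_at_right0 (R : realType) (u : nat -> R) : (forall n, 0 < u n) ->
  u @ \oo --> 0 -> u @ \oo --> 0^'+.
Proof.
move=> u0 u_cvg S [e /= e0 He].
have /cvgrPdist_lt/(_ _ e0)[N _ HN] := u_cvg.
by exists N => // n Nn; apply: He (HN n Nn) (u0 n).
Qed.

Lemma powR_secant (R : realType) (p : R) :
  ((1 + h) `^ p - 1) / h @[h --> 0^'] --> p.
Proof.
have [D H] := is_derive1_powR p (@ltr01 R).
rewrite [X in _ --> X](_ : p = 'D_1 (@powR R ^~ p) 1); last first.
  by rewrite H powR1 mulr1.
have {}D : derivable (@powR R ^~ p) 1 1 by [].
apply: cvg_trans D; apply: near_eq_cvg; near=> h => /=.
by rewrite powR1 scaler1 [RHS]mulrC [1 + h]addrC.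
Unshelve. all: by end_near. Qed.

Section SurvivalDecay.
Variables (R : realType) (f : R -> R) (alpha : R).

(* With q n = 1 - iter n f 0 one has q n.+1 = q n * (1 - decay_rate f (q n)). *)
Definition decay_rate (s : R) : R := (f (1 - s) - (1 - s)) / s.
Local Notation A := decay_rate.

Hypotheses (f1 : f 1 = 1) (f0_ge0 : 0 <= f 0).
Hypothesis f_le : forall x y : R, 0 <= x -> x <= y -> y <= 1 -> f x <= f y.
Hypothesis f_convex : forall t x y : R, 0 <= t <= 1 -> 0 <= x <= 1 -> 0 <= y <= 1 ->
  f ((1 - t) * x + t * y) <= (1 - t) * f x + t * f y.
Hypothesis alpha_gt0 : 0 < alpha.
Hypothesis A_gt0 : forall s : R, 0 < s < 1 -> 0 < A s.
Hypothesis A_ratio : forall x : R, 0 < x -> A (x * s) / A s @[s --> 0^'+] --> x `^ alpha.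

Let phi s := f (1 - s) - (1 - s).

Let phiE (s : R) : s != 0 -> phi s = s * A s.
Proof. by move=> s0; rewrite /A mulrC divfK. Qed.

Let phi_convex (t x y : R) : 0 <= t <= 1 -> 0 <= x <= 1 -> 0 <= y <= 1 ->
  phi ((1 - t) * x + t * y) <= (1 - t) * phi x + t * phi y.
Proof.
move=> t01 x01 y01.
have /(f_convex t01) : 0 <= 1 - x <= 1 by lra.
have y1 : 0 <= 1 - y <= 1 by lra.
move=> /(_ _ y1); rewrite /phi.
have -> : (1 - t) * (1 - x) + t * (1 - y) = 1 - ((1 - t) * x + t * y) by ring.
by lra.
Qed.

(** [A s] is the slope of the chord from 0 to [s] of the convex function [phi], which vanishes at
    0. *)
Lemma decay_rate_le x y : 0 < x -> x <= y -> y <= 1 -> A x <= A y.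
Proof.
move=> x0 xy y1; have y0 := lt_le_trans x0 xy.
have t01 : 0 <= x / y <= 1.
  by rewrite divr_ge0 ?(ltW x0) ?(ltW y0)//= ler_pdivrMr// mul1r.
have y01 : 0 <= y <= 1 by rewrite (ltW y0).
have z01 : 0 <= (0 : R) <= 1 by rewrite lexx ler01.
have := phi_convex t01 z01 y01.
rewrite mulr0 add0r divfK ?lt0r_neq0// {2}/phi subr0 f1 subrr mulr0 add0r.
rewrite !phiE ?lt0r_neq0// => H.
by rewrite -(ler_pM2l x0) (le_trans H)// mulrA divfK ?lt0r_neq0.
Qed.

Let near0P (Q : R -> Prop) : (\forall s \near 0^'+, Q s) ->
  exists2 e : R, 0 < e < 1 & forall s : R, 0 < s < e -> Q s.
Proof.
move=> [e /= e0 He]; exists (Num.min e (1 / 2)).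
  by rewrite lt_min e0 divr_gt0//= gt_min; apply/orP; right; lra.
move=> s /andP[s0]; rewrite lt_min => /andP[se _].
by apply: He => //=; rewrite sub0r normrN gtr0_norm.
Qed.

(** Halving [s] multiplies [A] by about $2^{-\alpha}$, hence near 0 by at most the midpoint [rho]
    between this number and 1. So [A] decays geometrically along halvings, and monotonicity covers
    the points in between. *)
Lemma decay_rate_cvg0 : A s @[s --> 0^'+] --> (0 : R).
Proof.
have rho1 : (2^-1 : R) `^ alpha < 1.
  rewrite [ltRHS](_ : 1 = 1 `^ alpha); last by rewrite powR1.
  by apply: gt0_ltr_powR; rewrite ?nnegrE//; lra.
have rho0 : 0 < (2^-1 : R) `^ alpha by rewrite powR_gt0.
pose rho := (1 + 2^-1 `^ alpha) / 2.
have [e /andP[e0 e1] He] : exists2 e, 0 < e < 1 &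
    forall s, 0 < s < e -> A (2^-1 * s) <= rho * A s.
  have half0 : 0 < 2^-1 :> R by [].
  have d0 : 0 < rho - 2^-1 `^ alpha by rewrite /rho; lra.
  have /cvgrPdist_le/(_ _ d0)/near0P[e e01 He] := A_ratio half0.
  exists e => // s se; have := He s se; rewrite distrC => /ler_normlW.
  rewrite lerD2r ler_pdivrMr//; apply: A_gt0; lra.
pose s0 := e / 2; have s00 : 0 < s0 < e by rewrite /s0; lra.
have As0 : 0 < A s0 by apply: A_gt0; lra.
have half_itv k : 0 < (2^-1 : R) ^+ k <= 1.
  by rewrite exprn_gt0//= exprn_ile1//; lra.
have sk k : 0 < 2^-1 ^+ k * s0 < e.
  have /andP[k0 k1] := half_itv k; have /andP[? se] := s00.
  by rewrite mulr_gt0//= (le_lt_trans _ se)// ler_piMl// ltW.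
have geo k : A (2^-1 ^+ k * s0) <= rho ^+ k * A s0.
  elim: k => [|k IH]; first by rewrite !expr0 !mul1r.
  rewrite !exprS -mulrA (le_trans (He _ (sk k)))// -mulrA ler_pM2l//.
  by rewrite /rho; lra.
apply/cvgrPdist_lt => eps eps0.
have rhoN : `|rho| < 1 by rewrite ger0_norm /rho; lra.
have /cvgrPdist_lt/(_ (eps / A s0) (divr_gt0 eps0 As0))[k _ Hk] := cvg_expr rhoN.
have := Hk k (leqnn k); rewrite /= sub0r normrN => /ltr_normlW Ak.
have /andP[k0 ke] := sk k.
exists (2^-1 ^+ k * s0) => // s /=; rewrite sub0r normrN => + s_gt0.
rewrite gtr0_norm// => sk'; rewrite sub0r normrN gtr0_norm; last by apply: A_gt0; lra.
apply: (@le_lt_trans _ _ (A (2^-1 ^+ k * s0))).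
  by apply: decay_rate_le; lra.
by apply: le_lt_trans (geo k) _; rewrite -ltr_pdivlMr.
Qed.

(** Otherwise [f] equals 1 on the whole interval from [s] to 1, so [A] equals 1 near 0 and cannot
    tend to 0. *)
Lemma f_lt1 s : 0 <= s -> s < 1 -> f s < 1.
Proof.
move=> s0 s1; rewrite ltNge; apply/negP => fs.
have /cvgrPdist_lt/(_ _ ltr01)/near0P[e /andP[e0 e1] He] := decay_rate_cvg0.
pose x := Num.min (e / 2) (1 - s).
have x0 : 0 < x by rewrite lt_min divr_gt0//= subr_gt0.
have xe : x < e by rewrite gt_min; apply/orP; left; lra.
have xs : x <= 1 - s by rewrite ge_min lexx orbT.
have fx : f (1 - x) = 1.
  apply/eqP; rewrite eq_le; apply/andP; split.
    by rewrite -[leRHS]f1; apply: f_le; lra.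
  by apply: (le_trans fs); apply: f_le; lra.
have := He x; rewrite x0 xe => /(_ isT).
rewrite /A fx (_ : 1 - (1 - x) = x); last by ring.
by rewrite divff ?lt0r_neq0// sub0r normrN normr1 ltxx.
Qed.

(** For the branching process without immigration and with one ancestor, this is the probability of
    being alive at generation [n]. *)
Definition survival n := 1 - iter n f 0.
Local Notation q := survival.

Let q0 : q 0 = 1. Proof. by rewrite /q subr0. Qed.

Lemma survival_gt0_le1 n : 0 < q n <= 1.
Proof.
elim: n => [|n]; first by rewrite q0 ltr01 lexx.
rewrite /survival iterS => IH.
have H : 0 <= iter n f 0 by lra.
have : f (iter n f 0) < 1 by apply: f_lt1; lra.
have : f 0 <= f (iter n f 0) by apply: f_le; lra.
move=> fn fn1; apply/andP; split; first by lra.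
by rewrite gerBl (le_trans f0_ge0).
Qed.

Lemma survivalS n : q n.+1 = q n * (1 - A (q n)).
Proof.
have /andP[qn _] := survival_gt0_le1 n.
rewrite mulrBr mulr1 -phiE ?lt0r_neq0// /phi /q iterS (_ : 1 - (1 - iter n f 0) = iter n f 0) //; by ring.
Qed.

Let A_ge0 s : 0 < s <= 1 -> 0 < A s.
Proof.
move=> /andP[s0 s1]; apply: (@lt_le_trans _ _ (A (s / 2))).
  by apply: A_gt0; lra.
by apply: decay_rate_le; lra.
Qed.

Let A_q n : 0 < A (q n) < 1.
Proof.
rewrite A_ge0 ?survival_gt0_le1//=.
have /andP[q1 _] := survival_gt0_le1 n.+1.
have /andP[qn _] := survival_gt0_le1 n.
by move: q1; rewrite survivalS pmulr_rgt0// subr_gt0.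
Qed.

Lemma survival_noninc n : q n.+1 <= q n.
Proof.
have /andP[qn _] := survival_gt0_le1 n; have /andP[a _] := A_q n.
by rewrite survivalS ler_piMr// ?ltW//; lra.
Qed.

(** If [q] stayed above some [e > 0], each step would multiply it by at most [1 - A e < 1], and it
    would decay geometrically. *)
Lemma survival_cvg0 : q @ \oo --> (0 : R).
Proof.
apply/cvgrPdist_lt => eps eps0.
pose e := Num.min eps 1.
have e0 : 0 < e by rewrite lt_min eps0 ltr01.
have e1 : e <= 1 by rewrite ge_min lexx orbT.
suff [N HN] : exists N, q N < e.
  exists N => // n Nn /=; have /andP[qn _] := survival_gt0_le1 n.
  rewrite sub0r normrN gtr0_norm//; apply: (@le_lt_trans _ _ (q N)).
    by apply: (@nonincreasing_seqP _ _ q).1 => // ?; exact: survival_noninc.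
  by apply: (lt_le_trans HN); rewrite ge_min lexx.
apply: contrapT => /forallNP Hq.
have qe n : e <= q n by rewrite leNgt; apply/negP/Hq.
have Ae : 0 < A e < 1.
  have /andP[_] := A_q 0; rewrite q0 => A1.
  by rewrite A_ge0 ?e0//= (le_lt_trans _ A1)// decay_rate_le.
have geo n : q n <= (1 - A e) ^+ n.
  elim: n => [|n IH]; first by rewrite q0.
  have /andP[qn q1] := survival_gt0_le1 n; have /andP[a a1] := A_q n.
  rewrite survivalS exprSr ler_pM ?(ltW qn)//; first by lra.
  by rewrite lerD2l lerN2 decay_rate_le.
have zN : `|1 - A e| < 1 by rewrite ger0_norm; lra.
have /cvgrPdist_lt/(_ _ e0)[n _ /(_ n (leqnn n))] := cvg_expr zN.
rewrite /= sub0r normrN => /ltr_normlW.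
by rewrite ltNge (le_trans (qe n) (geo n)).
Qed.


Let phi_ratio x : 0 < x -> phi (x * s) / phi s @[s --> 0^'+] --> x `^ (1 + alpha).
Proof.
move=> x0; have H : x * (A (x * s) / A s) @[s --> 0^'+] --> x * x `^ alpha.
  by apply: cvgM; [exact: cvg_cst|exact: A_ratio].
rewrite powRD; last by rewrite (lt0r_neq0 x0) implybT.
rewrite powRr1 ?ltW//; apply: cvg_trans H; apply: near_eq_cvg.
near=> s; have s0 : 0 < s by near: s; exact: nbhs_right_gt.
rewrite !phiE ?mulf_neq0 ?lt0r_neq0//.
have s1 : s < 1 by near: s; exact: nbhs_right_lt.
by field; rewrite !lt0r_neq0//; apply: A_gt0; rewrite s0.
Unshelve. all: by end_near. Qed.

(** The slope of [phi] over one step of the iteration, divided by [phi s / s]; a discrete form of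
    $s\phi'(s)/\phi(s)$. *)
Let kappa s := (phi s - phi (s * (1 - A s))) / (A s * phi s).

(* Convexity squeezes the slope of phi over [s * (1 - A s), s] between its slopes over
   [(1 - e) s, s] and [s, (1 + e) s], which regular variation determines. *)
Let kappa_bounds (s e : R) : 0 < s -> s <= 2^-1 -> 0 < e < 1 -> A s <= e ->
  (1 - phi ((1 - e) * s) / phi s) / e <= kappa s <= (phi ((1 + e) * s) / phi s - 1) / e.
Proof.
move=> s0 s2 /andP[e0 e1] ye.
have s1 : s < 1 by apply: le_lt_trans s2 _; rewrite invf_lt1// ltr1n.
have y0 : 0 < A s by apply: A_gt0; rewrite s0.
have phi0 : 0 < phi s by rewrite phiE ?lt0r_neq0// mulr_gt0.
have yphi : 0 < A s * phi s by rewrite mulr_gt0.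
have ep : 0 < 1 + e by rewrite addr_gt0.
have em : 0 < 1 - e by rewrite subr_gt0.
have y1 : 0 < 1 - A s by rewrite subr_gt0 (le_lt_trans ye).
have ye0 : 0 < A s + e by rewrite addr_gt0.
have mul01 (a x : R) : 0 < a <= 1 -> 0 < x <= 1 -> 0 <= a * x <= 1.
  move=> /andP[a0 a1] /andP[x0 x1].
  by rewrite mulr_ge0 ?mulr_ile1 ?(ltW a0) ?(ltW x0).
apply/andP; split; rewrite /kappa.
  have t01 : 0 <= A s / e <= 1.
    by rewrite divr_ge0 ?(ltW y0) ?(ltW e0)//= ler_pdivrMr// mul1r.
  have s01 : 0 <= s <= 1 by rewrite (ltW s0) (ltW s1).
  have z01 : 0 <= (1 - e) * s <= 1 by apply: mul01; rewrite ?em ?s0 ?gerBl ?(ltW s1) ?(ltW e0).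
  have := phi_convex t01 s01 z01.
  rewrite (_ : _ * s + _ = s * (1 - A s)); last by field; rewrite lt0r_neq0.
  set p1 := phi ((1 - e) * s); set p2 := phi (s * (1 - A s)) => H.
  rewrite ler_pdivlMr// [leLHS](_ : _ = (A s / e) * (phi s - p1)); last first.
    by field; rewrite !lt0r_neq0.
  rewrite lerBrDr (le_trans (lerD (lexx _) H))// le_eqVlt; apply/orP; left.
  by apply/eqP; ring.
have t01 : 0 <= A s / (A s + e) <= 1.
  by rewrite divr_ge0 ?(ltW y0) ?(ltW ye0)//= ler_pdivrMr// mul1r lerDl ltW.
have s01 : 0 <= s * (1 - A s) <= 1.
  by apply: mul01; rewrite ?s0 ?y1 ?gerBl ?(ltW s1) ?(ltW y0).
have z01 : 0 <= (1 + e) * s <= 1.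
  rewrite mulr_ge0 ?(ltW ep) ?(ltW s0)//= (@le_trans _ _ (2 * 2^-1))//.
    by rewrite ler_pM// ?(ltW ep) ?(ltW s0)// lerD2l ltW.
  by rewrite divff.
have := phi_convex t01 s01 z01.
rewrite [X in phi X <= _](_ : _ = s); last by field; rewrite lt0r_neq0.
set p1 := phi ((1 + e) * s); set p2 := phi (s * (1 - A s)).
rewrite -(ler_pM2l ye0) [leRHS](_ : _ = e * p2 + A s * p1); last first.
  by field; rewrite lt0r_neq0.
move=> H; rewrite ler_pdivrMr// [leRHS](_ : _ = A s * (p1 - phi s) / e); last first.
  by field; rewrite !lt0r_neq0.
rewrite ler_pdivlMr// -subr_ge0.
rewrite [leRHS](_ : _ = e * p2 + A s * p1 - (A s + e) * phi s); last by ring.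
by rewrite subr_ge0.
Qed.

Let kappa_cvg : kappa s @[s --> 0^'+] --> 1 + alpha.
Proof.
apply/cvgrPdist_le => eps eps0.
have eps2 : 0 < eps / 2 by rewrite divr_gt0.
have [e /andP[e0 e1] [He1 He2]] : exists2 e : R, 0 < e < 1 &
    `|(1 + alpha) - ((1 + e) `^ (1 + alpha) - 1) / e| <= eps / 2 /\
    `|(1 + alpha) - (1 - (1 - e) `^ (1 + alpha)) / e| <= eps / 2.
  have /cvgrPdist_le/(_ _ eps2)[e /= e0 He] := @powR_secant R (1 + alpha).
  (* The relative width is fixed before [s]: both one-sided difference quotients of $x^{1+\alpha}$
     at 1 with step [h] are already close to $1+\alpha$. *)
  pose h := Num.min (e / 2) (1 / 2).
  have h0 : 0 < h by rewrite lt_min !divr_gt0.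
  have h1 : h < 1 by rewrite gt_min; apply/orP; right; lra.
  have he : h < e by rewrite gt_min; apply/orP; left; lra.
  exists h; first by rewrite h0.
  split; first by apply: He; rewrite /= ?lt0r_neq0// sub0r normrN gtr0_norm.
  have := He (- h); rewrite /= sub0r opprK gtr0_norm// oppr_eq0 lt0r_neq0//.
  by move=> /(_ he isT); rewrite invrN mulrN -mulNr opprB.
have ee : 0 < e * (eps / 2) by rewrite mulr_gt0.
have ep : 0 < 1 + e by lra.
have em : 0 < 1 - e by lra.
near=> s.
have s0 : 0 < s by near: s; exact: nbhs_right_gt.
have s1 : s <= 2^-1 by near: s; apply: nbhs_right_le; rewrite invr_gt0.
have R1 : `|(1 + e) `^ (1 + alpha) - phi ((1 + e) * s) / phi s| <= e * (eps / 2).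
  by near: s; have /cvgrPdist_le := phi_ratio ep; exact.
have R2 : `|(1 - e) `^ (1 + alpha) - phi ((1 - e) * s) / phi s| <= e * (eps / 2).
  by near: s; have /cvgrPdist_le := phi_ratio em; exact.
have ye : A s <= e.
  near: s; have /cvgrPdist_le/(_ _ e0) := decay_rate_cvg0.
  by apply: filterS => s /=; rewrite sub0r normrN; exact: le_trans (ler_norm _).
have e01 : 0 < e < 1 by rewrite e0.
have /andP[K1 K2] := kappa_bounds s0 s1 e01 ye.
have L1 : (1 - (1 - e) `^ (1 + alpha)) / e - eps / 2 <= (1 - phi ((1 - e) * s) / phi s) / e.
  rewrite ler_pdivlMr// [leLHS](_ : _ = 1 - (1 - e) `^ (1 + alpha) - e * (eps / 2)).
    by move: R2; rewrite ler_norml => /andP[]; lra.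
  by field; rewrite lt0r_neq0.
have L2 : (phi ((1 + e) * s) / phi s - 1) / e <= ((1 + e) `^ (1 + alpha) - 1) / e + eps / 2.
  rewrite ler_pdivrMr// [leRHS](_ : _ = (1 + e) `^ (1 + alpha) - 1 + e * (eps / 2)).
    by move: R1; rewrite ler_norml => /andP[]; lra.
  by field; rewrite lt0r_neq0.
move: He1 He2; rewrite !ler_norml => /andP[? ?] /andP[? ?].
by apply/andP; split; lra.
Unshelve. all: by end_near. Qed.

(** With $y=A(s)$ the definition of [kappa] gives $A(s(1-y))=y(1-y\kappa)/(1-y)$, so the increment
    is $(\kappa-1)/(1-y\kappa)$, where $\kappa\to1+\alpha$ and $y\to0$. *)
Lemma decay_rate_inv_increment :
  (A (s * (1 - A s)))^-1 - (A s)^-1 @[s --> 0^'+] --> alpha.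
Proof.
have H : (kappa s - 1) / (1 - A s * kappa s) @[s --> 0^'+] -->
    ((1 + alpha) - 1) / (1 - 0 * (1 + alpha)).
  apply: cvgM; first by apply: cvgB; [exact: kappa_cvg|exact: cvg_cst].
  apply: cvgV; first by rewrite mul0r subr0 oner_neq0.
  apply: cvgB; first exact: cvg_cst.
  by apply: cvgM; [exact: decay_rate_cvg0|exact: kappa_cvg].
rewrite mul0r subr0 divr1 addrC addKr in H.
apply: cvg_trans H; apply: near_eq_cvg; near=> s.
have s0 : 0 < s by near: s; exact: nbhs_right_gt.
have s1 : s < 1 by near: s; exact: nbhs_right_lt.
have y0 : 0 < A s by apply: A_gt0; lra.
have y1 : A s < 1.
  near: s; have /cvgrPdist_lt/(_ _ ltr01) := decay_rate_cvg0.
  by apply: filterS => s /=; rewrite sub0r normrN; exact: le_lt_trans (ler_norm _).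
have s'0 : 0 < s * (1 - A s) by rewrite mulr_gt0// subr_gt0.
have A'0 : 0 < A (s * (1 - A s)) by apply: A_gt0; rewrite s'0/=; nra.
have E : 1 - A s * kappa s = (1 - A s) * A (s * (1 - A s)) / A s.
  rewrite /kappa !phiE ?lt0r_neq0//; field.
  by rewrite !lt0r_neq0.
have kE : A s * kappa s = 1 - (1 - A s) * A (s * (1 - A s)) / A s.
  by rewrite -E; ring.
rewrite E; have -> : kappa s = (1 - (1 - A s) * A (s * (1 - A s)) / A s) / A s.
  by rewrite -kE mulrC mulKf ?lt0r_neq0.
by field; rewrite !lt0r_neq0//; lra.
Unshelve. all: by end_near. Qed.

(** The increments of [1 / A (q n)] tend to [alpha]; their Cesaro means telescope. *)
Lemma decay_rate_survival : n%:R * A (q n) @[n --> \oo] --> alpha^-1.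
Proof.
pose w n := (A (q n.+1))^-1 - (A (q n))^-1.
have w_cvg : w @ \oo --> alpha.
  have q_right : q @ \oo --> 0^'+.
    by apply: cvg_at_right0 survival_cvg0 => n; have /andP[] := survival_gt0_le1 n.
  have := cvg_comp _ _ q_right decay_rate_inv_increment.
  by apply: cvg_trans; apply: near_eq_cvg; near=> n; rewrite /w/= survivalS.
have mean : arithmetic_mean w =
    fun n => n.+1%:R^-1 * ((A (q n.+1))^-1 - (A (q 0))^-1).
  apply/funext => n; congr (_ * _).
  exact: (@telescope_sumr _ 0 n.+1 (fun k => (A (q k))^-1)).
have := cesaro w_cvg; rewrite mean.
have harm : (A (q 0))^-1 * @harmonic R n @[n --> \oo] --> (A (q 0))^-1 * 0.
  by apply: cvgM; [exact: cvg_cst|exact: cvg_harmonic].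
move=> /(cvgD) /(_ harm); rewrite mulr0 addr0 => H.
have {}H : (n.+1%:R * A (q n.+1))^-1 @[n --> \oo] --> alpha.
  apply: cvg_trans H; apply: near_eq_cvg; near=> n.
  transitivity (n.+1%:R^-1 * ((A (q n.+1))^-1 - (A (q 0))^-1) +
    (A (q 0))^-1 * n.+1%:R^-1); first by [].
  by rewrite [RHS]invfM mulrBr [_^-1 * n.+1%:R^-1]mulrC subrK.
have {}H : n.+1%:R * A (q n.+1) @[n --> \oo] --> alpha^-1.
  apply: cvg_trans (cvgV (lt0r_neq0 alpha_gt0) H).
  by apply: near_eq_cvg; near=> n; rewrite /= invrK.
by rewrite -(cvg_shiftS (fun n => n%:R * A (q n))).
Unshelve. all: by end_near. Qed.

End SurvivalDecay.

(** * Regular variation at moving dilation factors *)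

Section MonotoneRegularVariation.
Variables (R : realType) (A : R -> R) (alpha : R).
Hypothesis A_le : forall x y : R, 0 < x -> x <= y -> y <= 1 -> A x <= A y.
Hypothesis A_gt0 : forall s : R, 0 < s < 1 -> 0 < A s.
Hypothesis A_ratio :
  forall x : R, 0 < x -> A (x * s) / A s @[s --> 0^'+] --> x `^ alpha.

(** Monotonicity of [A] traps the value at [x n] between those at the fixed factors [l - e] and
    [l + e], where the hypothesis applies; continuity of the power function at [l] closes the
    gap. *)
Lemma regular_variation_comp (x s : nat -> R) (l : R) : 0 < l -> (forall n, 0 < s n) ->
  s @ \oo --> 0 -> x @ \oo --> l -> A (x n * s n) / A (s n) @[n --> \oo] --> l `^ alpha.
Proof.
move=> l0 s_gt0 s_cvg x_cvg.
have s_right := cvg_at_right0 s_gt0 s_cvg.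
apply/cvgrPdist_le => eps eps0.
have eps2 : 0 < eps / 2 by rewrite divr_gt0.
have [e [e0 el He1 He2]] : exists e, [/\ 0 < e, e < l,
    `|l `^ alpha - (l - e) `^ alpha| <= eps / 2 &
    `|l `^ alpha - (l + e) `^ alpha| <= eps / 2].
  have : {for l, continuous (@powR R ^~ alpha)}.
    have [D _] := is_derive1_powR alpha l0.
    by apply: differentiable_continuous; exact/derivable1_diffP.
  move=> /cvgrPdist_le/(_ _ eps2)[e /= e0 He].
  have h0 : 0 < Num.min (e / 2) (l / 2) by rewrite lt_min !divr_gt0.
  have he : Num.min (e / 2) (l / 2) < e by rewrite gt_min; apply/orP; left; lra.
  have hl : Num.min (e / 2) (l / 2) < l by rewrite gt_min; apply/orP; right; lra.
  exists (Num.min (e / 2) (l / 2)); split => //; apply: He => /=.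
    by rewrite opprB addrC subrK gtr0_norm.
  by rewrite opprD addNKr normrN gtr0_norm.
have lm : 0 < l - e by rewrite subr_gt0.
have lp : 0 < l + e by rewrite addr_gt0.
have R1 := cvg_comp _ _ s_right (A_ratio lm).
have R2 := cvg_comp _ _ s_right (A_ratio lp).
near=> n.
have s0 := s_gt0 n.
have s1 : s n < 1.
  near: n; move/cvgrPdist_lt/(_ _ ltr01) : s_cvg.
  by apply: filterS => n; rewrite sub0r normrN; exact: le_lt_trans (ler_norm _).
have xs1 : (l + e) * s n <= 1.
  rewrite mulrC -ler_pdivlMr//.
  near: n; have i0 : 0 < 1 / (l + e) by rewrite divr_gt0.
  move/cvgrPdist_le/(_ _ i0) : s_cvg.
  by apply: filterS => n; rewrite sub0r normrN; exact: le_trans (ler_norm _).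
have xe : `|l - x n| <= e by near: n; move/cvgrPdist_le : x_cvg; apply.
have A0 : 0 < A (s n) by apply: A_gt0; rewrite s0.
have /andP[x1 x2] : l - e <= x n <= l + e by move: xe; rewrite ler_distlC.
have B1 : A ((l - e) * s n) / A (s n) <= A (x n * s n) / A (s n).
  rewrite ler_pM2r ?invr_gt0//; apply: A_le; first by rewrite mulr_gt0.
    by rewrite ler_pM2r.
  by rewrite (le_trans _ xs1)// ler_pM2r.
have B2 : A (x n * s n) / A (s n) <= A ((l + e) * s n) / A (s n).
  rewrite ler_pM2r ?invr_gt0//; apply: A_le => //.
    by rewrite mulr_gt0// (lt_le_trans lm).
  by rewrite ler_pM2r.
have C1 : `|(l - e) `^ alpha - A ((l - e) * s n) / A (s n)| <= eps / 2.
  by near: n; move/cvgrPdist_le : R1; apply.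
have C2 : `|(l + e) `^ alpha - A ((l + e) * s n) / A (s n)| <= eps / 2.
  by near: n; move/cvgrPdist_le : R2; apply.
move: (ler_normlW He1) (ler_normlW C1) B1 => {He1 C1} H1 H2 H3.
rewrite distrC in He2; rewrite distrC in C2.
move: (ler_normlW He2) (ler_normlW C2) B2 => {He2 C2} H4 H5 H6.
by rewrite ler_distlC; apply/andP; split; lra.
Unshelve. all: by end_near. Qed.

End MonotoneRegularVariation.

(** * Inverting the survival probability *)

Section SurvivalInverse.
Variables (R : realType) (A : R -> R) (q : nat -> R) (a : R).
Hypothesis A_le : forall x y : R, 0 < x -> x <= y -> y <= 1 -> A x <= A y.
Hypothesis A_gt0 : forall s : R, 0 < s < 1 -> 0 < A s.
Hypothesis A_cvg0 : A s @[s --> 0^'+] --> (0 : R).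
Hypotheses (q0 : q 0 = 1) (q_gt0 : forall n, 0 < q n <= 1).
Hypotheses (q_noninc : forall n, q n.+1 <= q n) (q_cvg0 : q @ \oo --> (0 : R)).
Hypothesis Aq : n%:R * A (q n) @[n --> \oo] --> a.

Let q_le m n : (m <= n)%N -> q n <= q m.
Proof. by move/subnK <-; elim: (n - m)%N => // j; exact/le_trans/q_noninc. Qed.

(** [A] itself is never inverted: [s n] lies between consecutive values of [q], so monotonicity
    gives [N n * A (s n) --> a], and division by [n * A (s n) --> kappa] gives the quotient. *)
Lemma survival_inverse (s : nat -> R) (kappa : R) :
    (forall n, 0 < s n <= 1) -> s @ \oo --> 0 ->
    0 < kappa -> n%:R * A (s n) @[n --> \oo] --> kappa ->
  exists N : nat -> nat, [/\ forall n, q (N n).+1 < s n <= q (N n),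
    N @ \oo --> \oo & (N n)%:R / n%:R @[n --> \oo] --> a / kappa].
Proof.
move=> s01 s_cvg kappa0 As.
have ex n : exists N, q N.+1 < s n <= q N.
  have /andP[sn sn1] := s01 n.
  have ex' : exists M, q M < s n.
    have /cvgrPdist_lt/(_ _ sn)[M _ /(_ M (leqnn M))] := q_cvg0.
    by rewrite /= sub0r normrN gtr0_norm ?(andP (q_gt0 M)).1// => ?; exists M.
  (* The least index with [q M < s n] is positive because [q 0 = 1]; its predecessor is the
     witness. *)
  case: (ex_minnP ex') => -[|M] HM minM; first by move: HM; rewrite q0 ltNge sn1.
  by exists M; rewrite HM leNgt /=; apply/negP => /minM; rewrite ltnn.
have [N HN] := choice ex; exists N.
have N_oo : N @ \oo --> \oo.
  apply/cvgnyPge => K.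
  have /andP[qK _] := q_gt0 K.
  move/cvgrPdist_lt/(_ _ qK) : s_cvg; apply: filterS => n /=.
  have /andP[sn _] := s01 n; rewrite sub0r normrN gtr0_norm// => sq.
  have /andP[qN _] := HN n; rewrite leqNgt; apply/negP => NK.
  by move: (lt_trans qN sq); rewrite ltNge q_le.
split => //.
have NS_oo : (fun n => (N n).+1) @ \oo --> \oo.
  apply/cvgnyPge => K; move/cvgnyPge/(_ K) : N_oo.
  by apply: filterS => n; exact: leqW.
have AqN : (N n)%:R * A (q (N n)) @[n --> \oo] --> a := cvg_comp _ _ N_oo Aq.
(* The mismatch between the factor [N n] and the index [(N n).+1] costs one term [A (q (N n).+1)],
   which tends to 0. *)
have AqNS : (N n)%:R * A (q (N n).+1) @[n --> \oo] --> a.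
  have q_right : q @ \oo --> 0^'+.
    by apply: cvg_at_right0 q_cvg0 => n; have /andP[] := q_gt0 n.
  have AA := cvg_comp _ _ NS_oo (cvg_comp _ _ q_right A_cvg0).
  have H : (N n).+1%:R * A (q (N n).+1) - A (q (N n).+1) @[n --> \oo] --> a - 0.
    by apply: cvgB; [exact: (cvg_comp _ _ NS_oo Aq)|exact: AA].
  rewrite subr0 in H; apply: cvg_trans H; apply: near_eq_cvg; near=> n => /=.
  by rewrite -natr1; ring.
have ANs : (N n)%:R * A (s n) @[n --> \oo] --> a.
  apply: (squeeze_cvgr _ AqNS AqN); near=> n.
  have /andP[qs sq] := HN n; have /andP[s0 s1] := s01 n.
  have /andP[? ?] := q_gt0 (N n).+1; have /andP[? ?] := q_gt0 (N n).
  by rewrite !ler_wpM2l//; apply: A_le => //; exact: ltW.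
apply: cvg_trans (cvgM ANs (cvgV (lt0r_neq0 kappa0) As)); apply: near_eq_cvg; near=> n => /=.
have n0 : (0 < n)%N by near: n; exists 1%N.
have A0 : A (s n) != 0.
  have /andP[sn _] := s01 n; rewrite lt0r_neq0// A_gt0// sn/=.
  near: n; move/cvgrPdist_lt/(_ _ ltr01) : s_cvg.
  by apply: filterS => n; rewrite sub0r normrN; exact: le_lt_trans (ler_norm _).
by field; rewrite A0 pnatr_eq0 -lt0n n0.
Unshelve. all: by end_near. Qed.

End SurvivalInverse.

(** * Weierstrass approximation *)

Section Bernstein.
Variable R : realType.
Implicit Types (phi psi : nat -> R) (y : R).

(* Bernstein's operator, the mean of phi under the binomial law (n, y), unfolded on the
   first of the n trials. *)
Fixpoint bernstein n phi : {poly R} :=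
  if n is n'.+1 then 'X * bernstein n' (phi \o succn) + (1 - 'X) * bernstein n' phi
  else (phi 0%N)%:P.

Lemma bernstein_le n phi psi y : 0 <= y <= 1 ->
  (forall k, (k <= n)%N -> phi k <= psi k) -> (bernstein n phi).[y] <= (bernstein n psi).[y].
Proof.
move=> /andP[y0 y1]; elim: n phi psi => [|n IH] phi psi le_pp /=.
  by rewrite !hornerC le_pp.
rewrite !(hornerD, hornerM) hornerN hornerX -polyC1 hornerC lerD// ler_wpM2l ?subr_ge0//.
  by apply: IH => k kn /=; exact: le_pp.
by apply: IH => k kn; exact/le_pp/leqW.
Qed.

(** These are the first two moments of the binomial law. General coefficients make the induction
    work, since the shift by [succn] again yields a quadratic. *)
Lemma bernstein_quadratic n (a b c : R) y :
  (bernstein n (fun k => a + b * k%:R + c * k%:R ^+ 2)).[y] =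
  a + b * (n%:R * y) + c * (n%:R * y * (1 - y) + (n%:R * y) ^+ 2).
Proof.
elim: n a b c => [|n IH] a b c /=; first by rewrite hornerC; ring.
have -> : (fun k => a + b * k%:R + c * k%:R ^+ 2) \o succn =
    fun k => (a + b + c) + (b + 2 * c) * k%:R + c * k%:R ^+ 2.
  by apply/funext => k /=; rewrite -(natr1 k); ring.
by rewrite hornerD !hornerM hornerD hornerN hornerX -polyC1 hornerC !IH -(natr1 n); ring.
Qed.

(** Close to the diagonal continuity gives [eps]; away from it the quadratic term exceeds [2 * B]. A
    quadratic bound is one whose image under [bernstein] is explicit. *)
Let quadratic_modulus (H : R -> R) (B eps : R) : continuous H ->
    (forall y, 0 <= y <= 1 -> `|H y| <= B) -> 0 < eps ->
  exists2 D, 0 <= D & forall y z, 0 <= y <= 1 -> 0 <= z <= 1 ->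
    `|H y - H z| <= eps + D * (y - z) ^+ 2.
Proof.
move=> cH HB eps0.
have B0 : 0 <= B by rewrite (le_trans _ (HB 0 _)) ?lexx ?ler01.
(* Letting [D] run along a filter allows compactness of the interval to select one [D] for all
   [y]. *)
suff : \forall D \near +oo, `[0, 1]%classic `<=`
    [set y | forall z, 0 <= z <= 1 -> `|H y - H z| <= eps + D * (y - z) ^+ 2].
  move=> [D0 [_ HD]]; exists (Num.max (D0 + 1) 0); first by rewrite le_max lexx orbT.
  by move=> y z y01; apply: HD; rewrite /= ?in_itv//= lt_max ltrDl ltr01.
have /compact_near_coveringP/near_covering_withinP cov := @segment_compact R 0 1.
apply: cov => x.
rewrite /= in_itv/= => x01.
have eps2 : 0 < eps / 2 by rewrite divr_gt0.
have /cvgrPdist_le/(_ _ eps2)[e /= e0 He] := cH x.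
have e20 : 0 < e / 2 by rewrite divr_gt0.
near=> y D; rewrite /= in_itv/= => y01 z z01.
have xy : `|x - y| < e / 2.
  by near: y; exists (e / 2).
have xy' : `|x - y| < e by rewrite (lt_trans xy)// ltr_pdivrMr// ltr_pMr// ltr1n.
have [yz|yz] := ltP `|y - z| (e / 2).
  have xz : `|x - z| < e.
    by rewrite (le_lt_trans (ler_distD y _ _))// (splitr e) ltrD.
  rewrite (le_trans (ler_distD (H x) _ _))// [`|H y - _|]distrC.
  have D0 : 0 <= D * (y - z) ^+ 2 by rewrite mulr_ge0 ?sqr_ge0//; near: D; exact: nbhs_pinfty_ge.
  by rewrite -[leLHS]addr0 lerD// (splitr eps) lerD// He.
apply: (@le_trans _ _ (B + B)).
  by rewrite (le_trans (ler_normB _ _))// lerD// HB.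
have De : (B + B) / (e / 2) ^+ 2 <= D by near: D; apply: nbhs_pinfty_ge; rewrite num_real.
apply: (@le_trans _ _ (D * (y - z) ^+ 2)); last by rewrite lerDr ltW.
apply: (@le_trans _ _ ((B + B) / (e / 2) ^+ 2 * (y - z) ^+ 2)); last first.
  by rewrite ler_wpM2r// sqr_ge0.
rewrite mulrAC ler_pdivlMr ?exprn_gt0// ler_wpM2l ?addr_ge0//.
by rewrite -[leRHS]real_normK ?num_real// lerXn2r// nnegrE ltW.
Unshelve. all: by end_near. Qed.

(** For fixed [y], [H] lies between two quadratics centred at [y]. The positive operator [bernstein]
    preserves the inequalities and turns the square into the variance [y * (1 - y) / n.+1]. *)
Theorem weierstrass_approximation (H : R -> R) (B eps : R) : continuous H ->
    (forall y, 0 <= y <= 1 -> `|H y| <= B) -> 0 < eps ->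
  exists p : {poly R}, forall y, 0 <= y <= 1 -> `|H y - p.[y]| <= eps.
Proof.
move=> cH HB eps0; have eps2 : 0 < eps / 2 by rewrite divr_gt0.
have [D D0 HD] := quadratic_modulus cH HB eps2.
have [n nD] : exists n, D / (eps / 2) <= n.+1%:R.
  exists (Num.truncn (D / (eps / 2))).
  by rewrite ltW// truncnS_gt.
exists (bernstein n.+1 (fun k => H (k%:R / n.+1%:R))) => y y01.
have n0 : (n.+1%:R : R) != 0 by rewrite pnatr_eq0.
have itv k : (k <= n.+1)%N -> 0 <= (k%:R / n.+1%:R : R) <= 1.
  by move=> kn; rewrite divr_ge0//= ler_pdivrMr ?ltr0n// mul1r ler_nat.
have quad C c : (bernstein n.+1
    (fun k => C + c * (y - k%:R / n.+1%:R) ^+ 2)).[y] = C + c * (y * (1 - y) / n.+1%:R).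
  have -> : (fun k => C + c * (y - k%:R / n.+1%:R) ^+ 2) =
      fun k => (C + c * y ^+ 2) + (- 2 * c * y / n.+1%:R) * k%:R +
        (c / n.+1%:R ^+ 2) * k%:R ^+ 2.
    by apply/funext => k; field.
  by rewrite bernstein_quadratic; field.
have var : D * (y * (1 - y) / n.+1%:R) <= eps / 2.
  have /andP[y0 y1] := y01.
  rewrite mulrA ler_pdivrMr ?ltr0n//; move: nD; rewrite ler_pdivrMr// mulrC => nD.
  apply: le_trans nD; rewrite ler_piMr// mulr_ile1// ?subr_ge0// gerBl//.
rewrite ler_distlC; apply/andP; split.
  apply: (@le_trans _ _ (H y - eps / 2 + - D * (y * (1 - y) / n.+1%:R))).
    by rewrite mulNr; move: var; move: (D * _) => v; lra.
  rewrite -quad; apply: bernstein_le => // k kn /=.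
  have := HD _ _ y01 (itv k kn); rewrite ler_norml mulNr.
  by move: (D * _) => v /andP[]; lra.
apply: (@le_trans _ _ (H y + eps / 2 + D * (y * (1 - y) / n.+1%:R))); last first.
  by move: var; move: (D * _) => v; lra.
rewrite -quad; apply: bernstein_le => // k kn /=.
have := HD _ _ y01 (itv k kn); rewrite ler_norml.
by move: (D * _) => v /andP[]; lra.
Qed.

End Bernstein.

(** * Continuity theorem for Laplace transforms *)

Section LaplaceTransform.
Variable R : realType.
Implicit Types (h : R -> R) (E : (R -> R) -> R).

(** The bound concerns the half-line only, so that [exp_decay lam], unbounded on the negative axis
    for [lam > 0], qualifies. *)
Definition halfline_test h := continuous h /\ exists M, forall x, 0 <= x -> `|h x| <= M.

(** Common abstraction of conditional expectations, whose probability space changes with [n], and of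
    the integral against the limit law. *)
Record halfline_mean E : Prop := HalflineMean {
  mean_cst1 : E (fun=> 1) = 1;
  mean_linear : forall a h1 h2, halfline_test h1 -> halfline_test h2 ->
    E (fun x => a * h1 x + h2 x) = a * E h1 + E h2;
  mean_le : forall h1 h2, halfline_test h1 -> halfline_test h2 ->
    (forall x, 0 <= x -> h1 x <= h2 x) -> E h1 <= E h2 }.

Definition exp_decay (lam : R) : R -> R := fun x => expR (- (lam * x)).

Lemma halfline_test_linear a h1 h2 : halfline_test h1 -> halfline_test h2 ->
  halfline_test (fun x => a * h1 x + h2 x).
Proof.
move=> [c1 [M1 H1]] [c2 [M2 H2]]; split.
  by move=> x; apply: cvgD; [apply: cvgM; [exact: cvg_cst|exact: c1]|exact: c2].
exists (`|a| * M1 + M2) => x x0; rewrite (le_trans (ler_normD _ _))// normrM.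
by rewrite lerD ?ler_wpM2l ?H1 ?H2.
Qed.

Lemma halfline_test_cst a : halfline_test (fun=> a).
Proof. by split; [move=> x; exact: cvg_cst|exists `|a|]. Qed.

Lemma exp_decay_continuous lam : continuous (exp_decay lam).
Proof.
move=> x; apply: (@continuous_comp _ _ _ (fun x => - (lam * x)) expR).
  by apply: cvgN; apply: cvgM; [exact: cvg_cst|exact: cvg_id].
exact: continuous_expR.
Qed.

Lemma exp_decay_itv lam x : 0 <= lam -> 0 <= x -> 0 <= exp_decay lam x <= 1.
Proof.
by move=> l0 x0; rewrite expR_ge0 -expR0 ler_expR oppr_le0 mulr_ge0.
Qed.

Lemma halfline_test_exp_decay lam : 0 <= lam -> halfline_test (exp_decay lam).
Proof.
move=> l0; split; first exact: exp_decay_continuous.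
by exists 1 => x x0; have /andP[? ?] := exp_decay_itv l0 x0; rewrite ger0_norm.
Qed.

Section Continuity.
Variables (En : nat -> (R -> R) -> R) (E : (R -> R) -> R).
Hypothesis mean_En : \forall n \near \oo, halfline_mean (En n).
Hypothesis mean_E : halfline_mean E.
Hypothesis En_exp : forall lam, 0 <= lam ->
  En n (exp_decay lam) @[n --> \oo] --> E (exp_decay lam).
Hypothesis E_exp : E (exp_decay lam) @[lam --> 0^'+] --> (1 : R).

Let cvg_linear a h1 h2 : halfline_test h1 -> halfline_test h2 ->
  En n h1 @[n --> \oo] --> E h1 -> En n h2 @[n --> \oo] --> E h2 ->
  En n (fun x => a * h1 x + h2 x) @[n --> \oo] --> E (fun x => a * h1 x + h2 x).
Proof.
move=> t1 t2 c1 c2; rewrite (mean_linear mean_E)//.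
have : a * En n h1 + En n h2 @[n --> \oo] --> a * E h1 + E h2.
  by apply: cvgD => //; apply: cvgM => //; exact: cvg_cst.
apply: cvg_trans; apply: near_eq_cvg; move: mean_En; apply: filterS => n mn.
by rewrite (mean_linear mn).
Qed.

Let cvg_poly (p : {poly R}) lam : 0 <= lam ->
  halfline_test (fun x => p.[exp_decay lam x]) /\
  (En n (fun x => p.[exp_decay lam x]) @[n --> \oo] --> E (fun x => p.[exp_decay lam x])).
Proof.
move=> l0.
have -> : (fun x => p.[exp_decay lam x]) =
    fun x => \sum_(i < size p) p`_i * exp_decay (i%:R * lam) x.
  apply/funext => x; rewrite horner_coef; apply: eq_bigr => i _; congr (_ * _).
  by rewrite /exp_decay -expRM_natl mulrN mulrA.
elim: (size p) => [|m [tm cm]].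
  have -> : (fun x => \sum_(i < 0) p`_i * exp_decay (i%:R * lam) x) =
      fun x => (-1) * exp_decay lam x + exp_decay lam x.
    by apply/funext => x; rewrite big_ord0 mulN1r addNr.
  have t := halfline_test_exp_decay l0.
  by split; [exact: halfline_test_linear|apply: cvg_linear => //; exact: En_exp].
have -> : (fun x => \sum_(i < m.+1) p`_i * exp_decay (i%:R * lam) x) =
    fun x => p`_m * exp_decay (m%:R * lam) x +
      \sum_(i < m) p`_i * exp_decay (i%:R * lam) x.
  by apply/funext => x; rewrite big_ord_recr addrC.
have ml : 0 <= m%:R * lam by rewrite mulr_ge0.
have t := halfline_test_exp_decay ml.
by split; [exact: halfline_test_linear|apply: cvg_linear => //; exact: En_exp].
Qed.

Let approximation h M eps lam : 0 < lam -> 0 < eps -> continuous h ->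
    (forall x, 0 <= x -> `|h x| <= M) ->
  exists p : {poly R}, forall x, 0 <= x ->
    `|h x - p.[exp_decay lam x]| <= eps + M * (1 - exp_decay lam x).
Proof.
move=> lam0 eps0 ch hM.
have M0 : 0 <= M by rewrite (le_trans _ (hM 0 _)).
(* Under [y = exp_decay lam x] the end [y = 0] is infinity, where [h] need not have a limit. The
   factor [y] forces continuity there, at the price [M * (1 - exp_decay lam x)]; the maximum extends
   [H] by 0 to negative [y]. *)
pose H y := h (- ln y / lam) * Num.max y 0.
have HB y : 0 <= y <= 1 -> `|H y| <= M.
  move=> /andP[y0 y1]; rewrite /H normrM max_l// (ger0_norm y0).
  rewrite -[leRHS]mulr1 ler_pM// hM// divr_ge0 ?(ltW lam0)// oppr_ge0.
  by have [->|y_gt0] := eqVneq y 0; [rewrite ln0|rewrite ln_le0].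
have cH : continuous H.
  move=> y; have [y0|y0|->] := ltgtP y 0.
  - have c0 : (fun=> 0 : R) @ y --> H y.
      by rewrite /H max_r ?(ltW y0)// mulr0; exact: cvg_cst.
    apply: cvg_trans c0; apply: near_eq_cvg; near=> z; rewrite /H max_r ?mulr0//.
    by rewrite ltW//; near: z; exact: lt_nbhsl.
  - have c0 : (fun z => h (- ln z / lam) * z) @ y --> H y.
      rewrite /H max_l ?(ltW y0)//; apply: cvgM; last exact: cvg_id.
      apply: (@continuous_comp _ _ _ (fun y => - ln y / lam) h); last exact: ch.
      apply: cvgM; last exact: cvg_cst.
      by apply: cvgN; exact: continuous_ln.
    apply: cvg_trans c0; apply: near_eq_cvg; near=> z; rewrite /H max_l//.
    by rewrite ltW//; near: z; exact: lt_nbhsr.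
  - have H0 : H 0 = 0 by rewrite /H maxxx mulr0.
    apply/cvgrPdist_le => e e0.
    have eM : 0 < e / (M + 1) by rewrite divr_gt0// ltr_wpDl.
    near=> z; rewrite H0 sub0r normrN.
    have [z0|z0] := ltP 0 z; last by rewrite /H max_r// mulr0 normr0 ltW.
    have z1 : z <= 1.
      by rewrite ltW//; near: z; exact: lt_nbhsl.
    have ze : z <= e / (M + 1) by rewrite ltW//; near: z; exact: lt_nbhsl.
    have z01 : 0 <= - ln z / lam by rewrite divr_ge0 ?(ltW lam0)// oppr_ge0 ln_le0.
    rewrite /H max_l ?(ltW z0)// normrM (gtr0_norm z0).
    rewrite (le_trans (ler_pM _ _ (hM _ z01) ze)) ?(ltW z0)//.
    by rewrite mulrCA ler_piMr ?(ltW e0)// ler_pdivrMr ?mul1r ?lerDl ?ler01// ltr_wpDl.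
have [p Hp] := weierstrass_approximation cH HB eps0.
exists p => x x0; have e01 := exp_decay_itv (ltW lam0) x0.
have /andP[_ e1] := e01.
have HE : H (exp_decay lam x) = h x * exp_decay lam x.
  rewrite /H /exp_decay expRK opprK [lam * x]mulrC mulfK ?lt0r_neq0//.
  by rewrite max_l ?expR_ge0.
rewrite (le_trans (ler_distD (H (exp_decay lam x)) _ _))// addrC lerD ?Hp//.
rewrite HE -{1}[h x]mulr1 -mulrBr normrM ler_pM ?hM//.
by rewrite ger0_norm// subr_ge0.
Unshelve. all: by end_near. Qed.

(** Tightness is replaced by the term [M * (1 - E (exp_decay lam))]: it is small for small [lam]
    under [E], hence eventually under [En n], as Laplace transforms converge. *)
Theorem laplace_weak_cvg h : halfline_test h -> En n h @[n --> \oo] --> E h.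
Proof.
move=> th; have [ch [M hM]] := th; apply/cvgrPdist_le => eps eps0.
have M0 : 0 <= M by rewrite (le_trans _ (hM 0 _)).
(* Six errors of this size are added: two from [E], one from the polynomial, and three from
   [En n]. *)
have eps8 : 0 < eps / 8 by rewrite divr_gt0.
have [lam lam0 Elam] : exists2 lam, 0 < lam & M * (1 - E (exp_decay lam)) <= eps / 8.
  have e8 : 0 < eps / 8 / (M + 1) by rewrite divr_gt0// ltr_wpDl.
  have /cvgrPdist_le/(_ _ e8)[e /= e0 He] := E_exp.
  have e20 : 0 < e / 2 by rewrite divr_gt0.
  have := He (e / 2); rewrite /= sub0r normrN gtr0_norm//.
  have -> : e / 2 < e by rewrite ltr_pdivrMr// ltr_pMr// ltr1n.
  move=> /(_ isT e20) /ler_normlW; rewrite ler_pdivlMr ?ltr_wpDl// => H.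
  exists (e / 2) => //.
  apply: le_trans H; rewrite mulrC ler_wpM2l ?lerDl//.
  rewrite subr_ge0 -[leRHS](mean_cst1 mean_E); apply: (mean_le mean_E).
  - exact/halfline_test_exp_decay/ltW.
  - exact: halfline_test_cst.
  - by move=> x x0; have /andP[] := exp_decay_itv (ltW e20) x0.
have [p Hp] := approximation lam0 eps8 ch hM.
have [tp cp] := cvg_poly p (ltW lam0).
pose psi x := p.[exp_decay lam x].
have te := halfline_test_exp_decay (ltW lam0).
have t1 := halfline_test_cst 1.
have tc := halfline_test_cst (eps / 8 + M).
have bound E' : halfline_mean E' ->
    `|E' h - E' psi| <= eps / 8 + M * (1 - E' (exp_decay lam)).
  move=> mE'.
  pose chi x := (- M) * exp_decay lam x + (eps / 8 + M).
  have tchi : halfline_test chi by exact: halfline_test_linear.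
  have cE : E' (fun=> eps / 8 + M) = eps / 8 + M.
    (* A constant [a] is reached as [(a - 1) * 1 + 1], since linearity is only available in the form
       [a * h1 + h2]. *)
    have := mean_linear mE' (eps / 8 + M - 1) t1 t1.
    rewrite (mean_cst1 mE') mulr1 subrK => H; rewrite -[RHS]H.
    by congr E'; apply/funext => x; rewrite mulr1 subrK.
  have chiE : E' chi = eps / 8 + M * (1 - E' (exp_decay lam)).
    by rewrite /chi (mean_linear mE')// cE; ring.
  have Hchi x : 0 <= x -> `|h x - psi x| <= chi x.
    by move=> x0; rewrite (le_trans (Hp x x0))// le_eqVlt; apply/orP; left; apply/eqP; rewrite /chi; ring.
  rewrite -chiE ler_distlC; apply/andP; split.
    rewrite lerBlDr -[X in X + _]mul1r -(mean_linear mE')//.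
    apply: (mean_le mE') => //; first exact: halfline_test_linear.
    by move=> x x0; have := Hchi x x0; rewrite ler_norml mul1r => /andP[? ?]; lra.
  rewrite addrC -[X in X + _]mul1r -(mean_linear mE')//.
  apply: (mean_le mE') => //; first exact: halfline_test_linear.
  by move=> x x0; have := Hchi x x0; rewrite ler_norml mul1r => /andP[? ?]; lra.
have bE := bound _ mean_E.
have Mc : M * (1 - En n (exp_decay lam)) @[n --> \oo] --> M * (1 - E (exp_decay lam)).
  by apply: cvgM; [exact: cvg_cst|apply: cvgB; [exact: cvg_cst|exact/En_exp/ltW]].
near=> n.
have bEn : `|En n h - En n psi| <= eps / 8 + M * (1 - En n (exp_decay lam)).
  by apply: bound; near: n; exact: mean_En.
have b1 : `|E psi - En n psi| <= eps / 8.
  by near: n; move/cvgrPdist_le : cp; apply.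
have b2 : `|M * (1 - E (exp_decay lam)) - M * (1 - En n (exp_decay lam))| <= eps / 8.
  by near: n; move/cvgrPdist_le : Mc; apply.
rewrite distrC in b2; rewrite distrC in bEn; move/ler_normlW : b2 => b2.
apply: le_trans (ler_distD (E psi) _ _) _.
apply: le_trans (lerD bE (ler_distD (En n psi) _ _)) _.
apply: le_trans (lerD (lexx _) (lerD b1 bEn)) _.
move: b2 Elam; move: (M * _) (M * _) => v1 v2; lra.
Unshelve. all: by end_near. Qed.

End Continuity.
End LaplaceTransform.

(** * Conditional expectations, scaling and the survival event *)

Lemma cond_expect_mean (R : realType) d (T : measurableType d) (P : probability T R)
    (X : T -> R) (A : set T) :
  measurable A -> P A != 0%E -> measurable_fun setT X -> (forall w, A w -> 0 <= X w) ->
  halfline_mean (fun h => cond_expect P (h \o X) A).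
Proof.
move=> mA PA0 mX X0.
have PA_fin : P A \is a fin_num by exact: fin_num_measure.
have fA0 : fine (P A) != 0 by rewrite fine_eq0.
have int h : halfline_test h -> P.-integrable A (EFin \o (h \o X)).
  move=> [ch [M HM]]; apply: measurable_bounded_integrable => //.
  - by rewrite ltey_eq PA_fin.
  - apply: measurable_funTS; apply: measurableT_comp => //.
    exact: continuous_measurable_fun.
  - exists M; split; first exact: num_real.
    by move=> x Mx w Aw /=; rewrite (le_trans (HM _ (X0 w Aw)))// ltW.
split.
- rewrite /cond_expect (_ : (fun=> 1) \o X = cst 1)//.
  by rewrite Rintegral_cst// mul1r divff.
- move=> a h1 h2 t1 t2; rewrite /cond_expect/=.
  have ta : halfline_test (fun x => a * h1 x).
    have := halfline_test_linear a t1 (halfline_test_cst 0).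
    by congr halfline_test; apply/funext => x; rewrite addr0.
  rewrite (@RintegralD _ _ _ _ _ (fun w => a * h1 (X w)) (h2 \o X)) //; last 2 first.
  + exact: (int _ ta).
  + exact: int.
  by rewrite RintegralZl//; [rewrite mulrDl mulrA|exact: int].
- move=> h1 h2 t1 t2 h12; rewrite /cond_expect ler_wpM2r ?invr_ge0 ?fine_ge0//.
  by apply: le_Rintegral => //; [exact: int|exact: int|move=> w /X0 /h12].
Qed.

(** Conditioning on the half-line, which has full mass, changes no integral, so this is an instance
    of conditional expectation. *)
Lemma halfline_law_mean (R : realType) (L : probability (measurableTypeR R) R) :
  L [set x : R | 0 <= x] = 1%E -> halfline_mean (fun h => (\int[L]_x h x)%R).
Proof.
move=> L1; set A := [set x : R | 0 <= x] in L1.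
have AE : A = `[0, +oo[%classic by apply/seteqP; split => x; rewrite /= in_itv/= andbT.
have mA : measurable (A : set (measurableTypeR R)) by rewrite AE; exact: measurable_itv.
have PA : L A != 0%E by rewrite L1 oner_neq0.
have M := @cond_expect_mean R _ _ L id A mA PA (@measurable_id _ _ _) (fun w Aw => Aw).
have E h : halfline_test h -> (\int[L]_x h x)%R = cond_expect L (h \o id) A.
  move=> [ch _]; rewrite /cond_expect L1 divr1 /Rintegral; congr fine.
  rewrite [RHS]integral_mkcond.
  have mh : measurable_fun [set: measurableTypeR R] (EFin \o h).
    by apply/measurable_EFinP; exact: continuous_measurable_fun.
  have LN : L (~` A) = 0%E by rewrite probability_setC// L1 subee.
  apply: ae_eq_integral => //.
  - by apply/measurable_restrict => //; rewrite setTI; exact: measurable_funTS.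
  - exists (~` A); split; [exact: measurableC|exact: LN|].
    move=> x /= Hx Ax; apply: Hx => _; rewrite patchE mem_set//.
have t1 := halfline_test_cst (1 : R).
split.
- by rewrite E// (mean_cst1 M).
- move=> a h1 h2 th1 th2; rewrite !E//; last exact: halfline_test_linear.
  exact: (mean_linear M).
- by move=> h1 h2 th1 th2 h12; rewrite !E//; exact: (mean_le M).
Qed.

(** The factor 1/2 suffices: eventually [b n./2 <= r * b n] with [r < 1], so each doubling of the
    index multiplies [b] by at least [1 / r]. Repeated halving leads back to finitely many positive
    values, which bound [b] from below. *)
Lemma scaling_seq_pinfty (R : realType) (rho : R) (b : nat -> R) : 0 < rho ->
  (forall n, 0 < b n) -> regularly_varying_seq rho b -> b @ \oo --> +oo.
Proof.
move=> rho0 b0 /(_ 2^-1 (ltac:(by rewrite invr_gt0))) /= Hb.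
have half n : Num.truncn (2^-1 * n%:R : R) = n./2.
  apply: truncn_def; rewrite mulrC ler_pdivlMr// ltr_pdivrMr// -!natrM.
  by rewrite ler_nat ltr_nat !muln2 -{2 3}(odd_double_half n); case: (odd n); lia.
have r1 : (2^-1 : R) `^ rho < 1.
  rewrite [ltRHS](_ : 1 = 1 `^ rho); last by rewrite powR1.
  by apply: gt0_ltr_powR; rewrite ?nnegrE//; lra.
have r0 : 0 < (2^-1 : R) `^ rho by rewrite powR_gt0// invr_gt0.
pose r := (1 + 2^-1 `^ rho) / 2.
have [rpos rlt1] : 0 < r /\ r < 1 by rewrite /r; split; lra.
have [n0 Hn0] : exists n0, forall n, (n0 <= n)%N -> b n./2 <= r * b n.
  have d0 : 0 < r - 2^-1 `^ rho by rewrite /r; lra.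
  have /cvgrPdist_le/(_ _ d0)[n0 _ H] := Hb; exists n0 => n nn.
  have := H n nn; rewrite /= half distrC => /ler_normlW.
  by rewrite lerD2r ler_pdivrMr.
have [m m0 Hm] : exists2 m, 0 < m & forall n, (n <= n0)%N -> m <= b n.
  elim: n0 {Hn0} => [|k [m m0 Hm]].
    by exists (b 0%N) => // n; rewrite leqn0 => /eqP ->.
  exists (Num.min m (b k.+1)); first by rewrite lt_min m0 b0.
  move=> n; rewrite leq_eqVlt ge_min => /predU1P[->|/Hm ->//].
  by rewrite lexx orbT.
have bm n : m <= b n.
  elim/ltn_ind: n => n IH; have [nn|nn] := leqP n n0; first exact: Hm.
  have lt2 : (n./2 < n)%N by rewrite -divn2 ltn_Pdiv//; case: n nn {IH}.
  apply: (le_trans (IH _ lt2)); apply: (le_trans (Hn0 n (ltnW nn))).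
  by rewrite ler_piMl// ltW.
have bj j n : (2 ^ j * n0.+1 <= n)%N -> m <= r ^+ j * b n.
  elim: j n => [|j IH] n; first by rewrite expr0 mul1r.
  rewrite expnS => jn; have jn2 : (2 ^ j * n0.+1 <= n./2)%N.
    by rewrite -[leqLHS]doubleK half_leq// -mul2n mulnA.
  apply: (le_trans (IH _ jn2)); rewrite exprSr -mulrA ler_pM2l ?exprn_gt0//.
  apply: Hn0; apply: leq_trans jn; rewrite -expnS (leq_trans (leqnSn n0))//.
  by rewrite leq_pmull// expn_gt0.
apply/cvgryPge => C.
have rN : `|r| < 1 by rewrite gtr0_norm.
pose K := Num.max C 1; have K0 : 0 < K by rewrite lt_max ltr01 orbT.
have /cvgrPdist_le/(_ _ (divr_gt0 m0 K0))[j _ /(_ j (leqnn j))] := cvg_expr rN.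
rewrite /= sub0r normrN => /ler_normlW rj.
exists (2 ^ j * n0.+1)%N => // n /= jn.
apply: (@le_trans _ _ K); first by rewrite le_max lexx.
have := bj j n jn => H.
have : m <= m / K * b n by apply: (le_trans H); rewrite ler_pM2r.
by rewrite mulrAC ler_pdivlMr// ler_pM2l.
Qed.

(** The path is constant on each interval from [i / n] to [i.+1 / n], right end excluded. Without a
    zero up to index [m] the infimum is at least [m.+1 / n > t]; a zero at index [i <= m] makes it
    at most [i / n <= t]. *)
Lemma survival_event (R : realType) d (T : measurableType d) (P : probability T R)
    (Z : nat -> {RV P >-> nat}) (b : nat -> R) (n : nat) (t : R) :
  (0 < n)%N -> 0 < b n -> 0 <= t ->
  [set w | (t%:E < next_zero n%:R^-1 (scaled_path b n (fun m => Z m w)))%E] =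
  no_return Z (Num.truncn (n%:R * t)).
Proof.
move=> n0 bn t0; have n0' : 0 < n%:R :> R by rewrite ltr0n.
have nt0 : 0 <= n%:R * t by rewrite mulr_ge0.
have /andP[m1 m2] := truncn_itv nt0.
set m := Num.truncn _ in m1 m2 *.
have zeroE s w : scaled_path b n (fun m => Z m w) s = 0 <-> Z (Num.truncn (n%:R * s)) w = 0%N.
  rewrite /scaled_path; split=> [/eqP|->]; last by rewrite mul0r.
  by rewrite mulf_eq0 invr_eq0 (gt_eqF bn) orbF pnatr_eq0 => /eqP.
apply/seteqP; split => w /=; rewrite /next_zero; last first.
  move=> nr; apply: (@lt_le_trans _ _ (m.+1%:R / n%:R)%:E).
    by rewrite lte_fin ltr_pdivlMr// mulrC.
  apply/ereal_infP => _ [s /= [ns /zeroE Zs] <-]; rewrite lee_fin ler_pdivrMr// mulrC.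
  have ns1 : 1 < n%:R * s by rewrite mulrC -ltr_pdivrMr// mul1r.
  have /andP[s1 s2] := truncn_itv (ltW (lt_trans ltr01 ns1)).
  apply: le_trans s1; rewrite ler_nat ltnNge; apply/negP => sm.
  have := nr (Num.truncn (n%:R * s)); rewrite Zs sm andbT => /(_ _)/negP; apply => //.
  by rewrite truncn_gt0 ltW.
move=> tinf i /andP[i0 im]; apply/negP => /eqP Zi.
have : (ereal_inf [set s%:E | s in [set s | (n%:R^-1 < s)%R /\
    scaled_path b n (fun m => Z m w) s = 0%R]] <= (i%:R / n%:R)%:E)%E.
  apply/lee_addgt0Pr => e e0.
  (* For [i = 1] the time [i / n] itself is excluded by the strict inequality in [next_zero], so
     slightly later times are used; the bound 1/2 keeps them in the same step of the path. *)
  pose e' := Num.min (e * n%:R) (1 / 2).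
  have e'0 : 0 < e' by rewrite lt_min mulr_gt0//= divr_gt0.
  have e'1 : e' < 1 by rewrite gt_min; apply/orP; right; lra.
  apply: (@le_trans _ _ ((i%:R + e') / n%:R)%:E).
    apply: ereal_inf_lbound; exists ((i%:R + e') / n%:R) => //; split.
      rewrite -[ltLHS]mul1r ltr_pM2r ?invr_gt0// (@le_lt_trans _ _ i%:R) ?ler1n//.
      by rewrite ltrDl.
    apply/zeroE; rewrite mulrC divfK ?lt0r_neq0//.
    by rewrite (@truncn_def _ _ i)// lerDl ltW//= -natr1 ltrD2l.
  rewrite -EFinD lee_fin mulrDl lerD2l ler_pdivrMr//.
  by rewrite ge_min lexx.
move=> /(lt_le_trans tinf); rewrite lte_fin ltr_pdivlMr// mulrC ltNge.
by rewrite (le_trans _ m1)// ler_nat.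
Qed.

(** * The conditioned process *)

Lemma cvgny_ratio (R : realType) (m : nat -> nat) (t : R) : 0 < t ->
  (m n)%:R / n%:R @[n --> \oo] --> t -> m @ \oo --> \oo.
Proof.
move=> t0 mt; apply/cvgnyPge => K.
have t20 : 0 < t / 2 by rewrite divr_gt0.
near=> n; have n0 : 0 < n%:R :> R by rewrite ltr0n; near: n; exists 1%N.
have mn : t / 2 <= (m n)%:R / n%:R.
  near: n; move/cvgrPdist_le/(_ _ t20) : mt; apply: filterS => n /ler_normlW.
  by lra.
have nK : K%:R / (t / 2) <= n%:R.
  by near: n; exact: nbhs_infty_ger.
rewrite -(ler_nat R) (@le_trans _ _ (t / 2 * n%:R))//.
  by rewrite mulrC -ler_pdivrMr.
by rewrite -ler_pdivlMr.
Unshelve. all: by end_near. Qed.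

Section ConditionedProcess.
Variables (R : realType) (mu nu : probability nat R).
Variables (alpha c d : R) (l k : R -> R) (b : nat -> R).
Hypotheses (nu0 : 0 < mass nu 0) (SL : assumption_SL mu nu alpha c d l k).
Hypotheses (delta01 : 0 < d / (alpha * c) < 1) (hb : scaling_seq alpha l b).
Hypothesis killed_ge0_le : forall m (s s' : R), 0 <= s -> s <= s' -> s' <= 1 ->
  0 <= killed (gen_fun mu) (gen_fun nu) m s <= killed (gen_fun mu) (gen_fun nu) m s'.
Hypothesis killed_noninc : forall m,
  killed (gen_fun mu) (gen_fun nu) m.+1 1 <= killed (gen_fun mu) (gen_fun nu) m 1.

Local Notation f := (gen_fun mu).
Local Notation g := (gen_fun nu).
Local Notation A := (decay_rate f).
Local Notation q := (survival f).

Let alpha_gt0 : 0 < alpha. Proof. by case: SL => /andP[]. Qed.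
Let c_gt0 : 0 < c. Proof. by case: SL. Qed.
Let l_gt0 s : 0 < s < 1 -> 0 < l s. Proof. by case: SL => _ _ _ [+ _ _ _] _ => /[apply] -[]. Qed.

Let AE s : 0 < s < 1 -> A s = c * s `^ alpha * l s.
Proof.
move=> /andP[s0 s1]; case: SL => _ _ _ _ /(_ (1 - s)).
have s01 : 0 < 1 - s < 1 by rewrite subr_gt0 s1 gtrBl.
move=> /(_ s01)[fs _]; rewrite /A fs subKr addrC addKr.
rewrite powRD; last by rewrite (lt0r_neq0 s0) implybT.
by rewrite powRr1 ?ltW//; field; rewrite lt0r_neq0.
Qed.

Let gE s : 0 < s < 1 -> 1 - g (1 - s) = d * s `^ alpha * k s.
Proof.
move=> /andP[s0 s1]; case: SL => _ _ _ _ /(_ (1 - s)).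
have s01 : 0 < 1 - s < 1 by rewrite subr_gt0 s1 gtrBl.
by move=> /(_ s01)[_ ->]; rewrite !subKr.
Qed.

Let A_gt0 s : 0 < s < 1 -> 0 < A s.
Proof. by move=> s01; rewrite AE// !mulr_gt0 ?powR_gt0 ?l_gt0//; case/andP: s01. Qed.

Let A_ratio x : 0 < x -> A (x * s) / A s @[s --> 0^'+] --> x `^ alpha.
Proof.
move=> x0; case: SL => _ _ _ [_ sv _ _] _.
have H : x `^ alpha * (l (x * s) / l s) @[s --> 0^'+] --> x `^ alpha * 1.
  by apply: cvgM; [exact: cvg_cst|exact: sv].
rewrite mulr1 in H; apply: cvg_trans H; apply: near_eq_cvg; near=> s.
have s0 : 0 < s by near: s; exact: nbhs_right_gt.
have s1 : s < 1 by near: s; exact: nbhs_right_lt.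
have xs0 : 0 < x * s by rewrite mulr_gt0.
have xs1 : x * s < 1.
  rewrite mulrC -ltr_pdivlMr// div1r.
  by near: s; apply: nbhs_right_lt; rewrite invr_gt0.
rewrite !AE ?s0 ?xs0// powRM ?ltW//; field.
by rewrite !lt0r_neq0 ?powR_gt0 ?l_gt0// ?s0.
Unshelve. all: by end_near. Qed.

Let f0_ge0 : 0 <= f 0. Proof. by rewrite gen_fun0 mass_ge0. Qed.
Let f_le := @gen_fun_le R mu.
Let f_convex := @gen_fun_convex R mu.
Let f1 := @gen_fun1 R mu.

Let A_le := decay_rate_le f1 f_convex.
Let A_cvg0 := decay_rate_cvg0 f1 f_convex alpha_gt0 A_gt0 A_ratio.
Let q_itv := survival_gt0_le1 f1 f0_ge0 f_le f_convex alpha_gt0 A_gt0 A_ratio.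
Let q_noninc := survival_noninc f1 f0_ge0 f_le f_convex alpha_gt0 A_gt0 A_ratio.
Let q_cvg0 := survival_cvg0 f1 f0_ge0 f_le f_convex alpha_gt0 A_gt0 A_ratio.
Let Aq := decay_rate_survival f1 f0_ge0 f_le f_convex alpha_gt0 A_gt0 A_ratio.

Let iter_itv n : 0 <= iter n f 0 <= 1.
Proof.
have /andP[q0 q1] := q_itv n; move: q0 q1; rewrite /q subr_gt0 gerBl => ? ->.
exact: ltW.
Qed.

Let u n := immigration_prod f g n 0.

Let uS n : u n.+1 = u n * g (iter n f 0).
Proof. by rewrite /u /immigration_prod big_ord_recr. Qed.

Let g_gt0 s : 0 <= s <= 1 -> 0 < g s.
Proof.
by move=> /andP[s0 s1]; rewrite (lt_le_trans nu0)// -gen_fun0 gen_fun_le.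
Qed.

Let u_gt0 n : 0 < u n.
Proof. by apply: prodr_gt0 => i _; exact: g_gt0. Qed.

Let u_noninc n : u n.+1 <= u n.
Proof.
rewrite uS ler_piMr ?(ltW (u_gt0 _))//.
by have /andP[] := gen_fun_itv nu (iter_itv n).
Qed.

Let q_right : q @ \oo --> 0^'+.
Proof. by apply: cvg_at_right0 q_cvg0 => n; have /andP[] := q_itv n. Qed.

(** The bracket is [1 - g (1 - q n)], which equals [d / c * (k / l) * A] at [q n] by (SL), and
    [n * A (q n)] tends to [1 / alpha]. *)
Let u_ratio : n.+1%:R * (1 - u n.+1 / u n) @[n --> \oo] --> d / (alpha * c).
Proof.
have kl : k (q n) / l (q n) @[n --> \oo] --> (1 : R).
  case: SL => _ _ _ [_ _ _ lk] _.
  have H := cvg_comp _ _ q_right lk.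
  have H' : (l (q n) / k (q n))^-1 @[n --> \oo] --> (1 : R)^-1.
    by apply: cvgV; [exact: oner_neq0|exact: H].
  rewrite invr1 in H'; by apply: cvg_trans H'; apply: near_eq_cvg; near=> n => /=; rewrite invf_div.
have nA : n.+1%:R * A (q n) @[n --> \oo] --> alpha^-1.
  have H : n%:R * A (q n) + A (q n) @[n --> \oo] --> alpha^-1 + 0.
    by apply: cvgD; [exact: Aq|exact: (cvg_comp _ _ q_right A_cvg0)].
  rewrite addr0 in H; apply: cvg_trans H; apply: near_eq_cvg; near=> n.
  by rewrite -natr1 mulrDl mul1r.
have H : d / c * (k (q n) / l (q n)) * (n.+1%:R * A (q n)) @[n --> \oo] -->
    d / c * 1 * alpha^-1.
  by apply: cvgM => //; apply: cvgM => //; exact: cvg_cst.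
have E : d / c * 1 * alpha^-1 = d / (alpha * c).
  by field; rewrite !lt0r_neq0.
rewrite E in H; apply: cvg_trans H; apply: near_eq_cvg; near=> n.
have /andP[q0 _] := q_itv n.
have q1 : q n < 1.
  near: n; move/cvgrPdist_lt/(_ _ ltr01) : q_cvg0.
  by apply: filterS => n; rewrite sub0r normrN; exact: le_lt_trans (ler_norm _).
have q01 : 0 < q n < 1 by rewrite q0.
have un := lt0r_neq0 (u_gt0 n).
have -> : 1 - u n.+1 / u n = d * q n `^ alpha * k (q n).
  by rewrite -gE// /q subKr uS mulrAC divff// mul1r.
by rewrite AE//; field; rewrite !lt0r_neq0// l_gt0.
Unshelve. all: by end_near. Qed.

Let kappa lam := c * lam `^ alpha.

Let b_gt0 n : 0 < b n. Proof. by case: hb. Qed.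

Let binv_cvg0 : (b n)^-1 @[n --> \oo] --> (0 : R).
Proof.
case: hb => b0 rv _.
have : b @ \oo --> +oo by apply: scaling_seq_pinfty rv; rewrite ?invr_gt0.
by move=> /gtr0_cvgV0 H; apply/H; near=> n.
Unshelve. all: by end_near. Qed.

Let Ab : n%:R * A (b n)^-1 @[n --> \oo] --> c.
Proof.
case: hb => _ _ bl.
have H' : (b n `^ alpha / (n%:R * l (b n)^-1))^-1 @[n --> \oo] --> (1 : R)^-1.
  by apply: cvgV; [exact: oner_neq0|exact: bl].
rewrite invr1 in H'; have H : c * (b n `^ alpha / (n%:R * l (b n)^-1))^-1 @[n --> \oo] --> c * 1.
  by apply: cvgM => //; exact: cvg_cst.
rewrite mulr1 in H; apply: cvg_trans H; apply: near_eq_cvg; near=> n.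
have bi1 : (b n)^-1 < 1.
  near: n; move/cvgrPdist_lt/(_ _ ltr01) : binv_cvg0.
  by apply: filterS => n; rewrite sub0r normrN; exact: le_lt_trans (ler_norm _).
have bi01 : 0 < (b n)^-1 < 1 by rewrite invr_gt0 b_gt0.
have bE : (b n)^-1 `^ alpha = (b n `^ alpha)^-1.
  by rewrite -powR_inv1 ?(ltW (b_gt0 _))// -powRrM mulN1r powRN.
by rewrite AE// invf_div bE; field; rewrite lt0r_neq0// powR_gt0.
Unshelve. all: by end_near. Qed.

Let s_ lam n := 1 - expR (- (lam / b n)).

Let s_itv lam n : 0 < lam -> 0 < s_ lam n <= 1.
Proof.
move=> lam0; rewrite /s_ subr_gt0 gerBl expR_ge0 andbT.
by rewrite expR_lt1 oppr_lt0 divr_gt0.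
Qed.

(** Both bounds in $y/(1+y)\le 1-e^{-y}\le y$, at [y = lam / b n], come from $1+x\le e^x$. *)
Let s_scaled lam : 0 < lam -> b n * s_ lam n @[n --> \oo] --> lam.
Proof.
move=> lam0.
have lb : lam / b n @[n --> \oo] --> lam * 0.
  by apply: cvgM; [exact: cvg_cst|exact: binv_cvg0].
have low : lam / (1 + lam / b n) @[n --> \oo] --> lam / (1 + lam * 0).
  apply: cvgM; first exact: cvg_cst.
  apply: cvgV; first by rewrite mulr0 addr0 oner_neq0.
  by apply: cvgD => //; exact: cvg_cst.
rewrite mulr0 addr0 divr1 in low.
apply: (squeeze_cvgr _ low (cvg_cst lam)); near=> n.
have bn := b_gt0 n; have y0 : 0 < lam / b n by rewrite divr_gt0.
have y1 : 0 < 1 + lam / b n by rewrite addr_gt0.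
rewrite [b n * _]mulrC; apply/andP; split.
  rewrite -ler_pdivrMr// /s_ lerBrDr -lerBrDl.
  have -> : 1 - lam / (1 + lam / b n) / b n = (1 + lam / b n)^-1.
    by field; rewrite !lt0r_neq0//; rewrite addr_gt0.
  by rewrite expRN lef_pV2 ?posrE ?expR_gt0// expR_ge1Dx.
rewrite -ler_pdivlMr// /s_ lerBlDr -lerBlDl.
by rewrite (expR_ge1Dx (- (lam / b n))).
Unshelve. all: by end_near. Qed.

Let As lam : 0 < lam -> n%:R * A (s_ lam n) @[n --> \oo] --> kappa lam.
Proof.
move=> lam0.
have bi n : 0 < (b n)^-1 by rewrite invr_gt0.
have H := regular_variation_comp A_le A_gt0 A_ratio lam0 bi binv_cvg0 (s_scaled lam0).
apply: cvg_trans (cvgM Ab H); apply: near_eq_cvg; near=> n => /=.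
have bi1 : (b n)^-1 < 1.
  near: n; move/cvgrPdist_lt/(_ _ ltr01) : binv_cvg0.
  by apply: filterS => n; rewrite sub0r normrN; exact: le_lt_trans (ler_norm _).
have A0 : A (b n)^-1 != 0 by rewrite lt0r_neq0// A_gt0// bi.
have -> : b n * s_ lam n / b n = s_ lam n by rewrite mulrAC divff ?mul1r ?lt0r_neq0.
by field.
Unshelve. all: by end_near. Qed.


Let s_cvg0 lam : 0 < lam -> s_ lam @ \oo --> (0 : R).
Proof.
move=> lam0.
have H : b n * s_ lam n * (b n)^-1 @[n --> \oo] --> lam * 0.
  by apply: cvgM; [exact: s_scaled|exact: binv_cvg0].
rewrite mulr0 in H; apply: cvg_trans H; apply: near_eq_cvg; near=> n.
by rewrite mulrAC divff ?mul1r ?lt0r_neq0.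
Unshelve. all: by end_near. Qed.

Let r : fps R := fun m => killed f g m 1.

Let renewal_r : (u : fps R) * r = fps_geo R.
Proof.
apply/funext => m; rewrite fpsM killed_renewal /immigration_prod big1// => i _.
by rewrite (_ : iter i f 1 = 1) ?gen_fun1//; elim: (nat_of_ord i) => //= j ->.
Qed.

(** At [s = iter N f 0] the right side of the renewal equation becomes [u (j + N) / u N], because
    the product defining [u] splits after its first [N] factors. *)
Let killed_iter (eps : R) : 0 < eps -> exists M, forall N m : nat,
  (M <= N)%N -> (M <= m)%N -> 0 < r m /\
  `|killed f g m (iter N f 0) / r m - N%:R / (N%:R + m%:R)| <= eps.
Proof.
move=> eps0.
have r_ge0 m : 0 <= r m.
  by have /andP[] := killed_ge0_le m ler01 (lexx (1 : R)) (lexx (1 : R)).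
have u0 : u 0 = 1 by rewrite /u /immigration_prod big_ord0.
have [M HM] := renewal_killed_ratio u_gt0 u0 u_noninc delta01 u_ratio r_ge0
  killed_noninc renewal_r eps0.
exists M => N m MN Mm.
apply: (HM N m (fun j => killed f g j (iter N f 0)) MN Mm).
  move=> j; have /andP[i0 i1] := iter_itv N.
  exact: killed_ge0_le.
move=> j; rewrite fpsM killed_renewal /u immigration_prodD mulfK//.
exact/lt0r_neq0/u_gt0.
Qed.

Lemma no_return_gt0 : exists M, forall m, (M <= m)%N -> 0 < killed f g m 1.
Proof.
have [M HM] := killed_iter ltr01; exists M => m Mm.
by have [] := HM M m (leqnn M) Mm.
Qed.

Lemma conditional_laplace_cvg (t : R) (m : nat -> nat) (lam : R) :
    0 < t -> 0 < lam -> (m n)%:R / n%:R @[n --> \oo] --> t ->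
  killed f g (m n) (expR (- (lam / b n))) / killed f g (m n) 1 @[n --> \oo] -->
    (1 + alpha * c * t * lam `^ alpha)^-1.
Proof.
move=> t0 lam0 mt.
have kap0 : 0 < kappa lam by rewrite mulr_gt0// powR_gt0.
have q0 : q 0 = 1 by rewrite /survival subr0.
have [N [HN N_oo Nn]] := survival_inverse A_le A_gt0 A_cvg0 q0 q_itv q_noninc q_cvg0 Aq
  (fun n => s_itv n lam0) (s_cvg0 lam0) kap0 (As lam0).
(* This is the limit of [N n / n]; the limit sought is [theta / (theta + t)], since
   [t / theta = alpha * c * t * lam ^ alpha]. *)
pose theta := alpha^-1 / kappa lam.
have theta0 : 0 < theta by rewrite divr_gt0// invr_gt0.
have m_oo := cvgny_ratio t0 mt.
have ratio (N' : nat -> nat) : (N' n)%:R / n%:R @[n --> \oo] --> theta ->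
    (N' n)%:R / ((N' n)%:R + (m n)%:R) @[n --> \oo] --> (1 + alpha * c * t * lam `^ alpha)^-1.
  move=> N't.
  have H : (N' n)%:R / n%:R / ((N' n)%:R / n%:R + (m n)%:R / n%:R) @[n --> \oo] -->
      theta / (theta + t).
    by apply: cvgM => //; apply: cvgV; [rewrite lt0r_neq0// addr_gt0|exact: cvgD].
  have E : theta / (theta + t) = (1 + alpha * c * t * lam `^ alpha)^-1.
    rewrite /theta /kappa; have la := powR_gt0 alpha lam0.
    have den : 0 < 1 + alpha * c * t * lam `^ alpha.
      by rewrite addr_gt0// !mulr_gt0.
    by field; rewrite !lt0r_neq0//= ?addr_gt0 ?mulr_gt0.
  rewrite E in H; apply: cvg_trans H; apply: near_eq_cvg; near=> n.
  have n0 : (n%:R : R) != 0 by rewrite pnatr_eq0 -lt0n; near: n; exists 1%N.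
  have m0 : (0 < m n)%N by near: n; move/cvgnyPge : m_oo; apply.
  have Nm0 : (N' n)%:R + (m n)%:R != 0 :> R.
    by rewrite -natrD pnatr_eq0 -lt0n addn_gt0 m0 orbT.
  by field; rewrite n0 Nm0.
have NSn : (N n).+1%:R / n%:R @[n --> \oo] --> theta.
  have H : (N n)%:R / n%:R + n%:R^-1 @[n --> \oo] --> theta + 0.
    by apply: cvgD => //; rewrite -(@cvg_shiftS R (fun n => n%:R^-1)); exact: cvg_harmonic.
  rewrite addr0 in H; apply: cvg_trans H; apply: near_eq_cvg; near=> n.
  by rewrite -natr1 mulrDl mul1r.
have R1 := ratio _ Nn; have R2 := ratio _ NSn.
apply/cvgrPdist_le => eps eps0.
have eps2 : 0 < eps / 2 by rewrite divr_gt0.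
have [M HM] := killed_iter eps2.
near=> n.
have MN : (M <= N n)%N by near: n; move/cvgnyPge : N_oo; apply.
have Mm : (M <= m n)%N by near: n; move/cvgnyPge : m_oo; apply.
have [r0 K1] := HM _ _ MN Mm; have [_ K2] := HM _ _ (leqW MN) Mm.
have /andP[qs sq] := HN n.
have /andP[i0 i1] := iter_itv (N n); have /andP[j0 j1] := iter_itv (N n).+1.
set s := expR _.
have is1 : iter (N n) f 0 <= s by move: sq; rewrite /s_ /survival lerD2l lerN2.
have is2 : s <= iter (N n).+1 f 0.
  by move: qs; rewrite /s_ /survival ltrD2l ltrN2 => /ltW.
have B1 : killed f g (m n) (iter (N n) f 0) / r (m n) <= killed f g (m n) s / r (m n).
  rewrite ler_pM2r ?invr_gt0//.
  by have /andP[] := killed_ge0_le (m n) i0 is1 (le_trans is2 j1).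
have B2 : killed f g (m n) s / r (m n) <= killed f g (m n) (iter (N n).+1 f 0) / r (m n).
  rewrite ler_pM2r ?invr_gt0//.
  by have /andP[] := killed_ge0_le (m n) (le_trans i0 is1) is2 j1.
have C1 : `|(1 + alpha * c * t * lam `^ alpha)^-1 -
    (N n)%:R / ((N n)%:R + (m n)%:R)| <= eps / 2.
  by near: n; move/cvgrPdist_le : R1; apply.
have C2 : `|(1 + alpha * c * t * lam `^ alpha)^-1 -
    (N n).+1%:R / ((N n).+1%:R + (m n)%:R)| <= eps / 2.
  by near: n; move/cvgrPdist_le : R2; apply.
rewrite distrC in K1; rewrite distrC in C2.
rewrite ler_distlC; apply/andP; split.
  rewrite -[killed f g (m n) 1]/(r (m n)); apply: le_trans B1.
  move: (ler_normlW K1) (ler_normlW C1); rewrite !lerBlDr => k1 c1.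
  by rewrite (splitr eps) [leRHS]addrC -addrA (le_trans c1)// lerD2l.
rewrite -[killed f g (m n) 1]/(r (m n)); apply: (le_trans B2).
move: (ler_normlW K2) (ler_normlW C2); rewrite !lerBlDr => k2 c2.
by rewrite (splitr eps) [leRHS]addrC -addrA (le_trans k2)// lerD2l.
Unshelve. all: by end_near. Qed.

End ConditionedProcess.

Theorem theorem3 (R : realType) (mu nu : probability nat R)
    (mu1 : mass mu 1 < 1) (nu0 : 0 < mass nu 0)
    (alpha c d : R) (l k : R -> R) (SL : assumption_SL mu nu alpha c d l k)
    (delta01 : 0 < d / (alpha * c) < 1)
    (b : nat -> R) (hb : scaling_seq alpha l b)
    (disp : nat -> measure_display) (T : forall n, measurableType (disp n))
    (P : forall n, probability (T n) R)
    (Z1 : forall n, nat -> {RV (P n) >-> nat})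
    (hZ1 : forall n, is_BGWI mu nu (Z1 n))
    (t : R) (t_gt0 : 0 < t) (t_ : nat -> R) (t_cvg : t_ n @[n --> \oo] --> t) :
  let Z (n : nat) (w : T n) : R -> R :=
    scaled_path b n (fun m => Z1 n m w) in
  let A (n : nat) : set (T n) :=
    [set w | ((t_ n)%:E < next_zero n%:R^-1 (Z n w))%E] in
  (forall lam : R, 0 <= lam ->
     cond_expect (P n) (fun w => expR (- (lam * Z n w (t_ n)))) (A n)
       @[n --> \oo] --> (1 + alpha * c * t * lam `^ alpha)^-1) /\
  (forall L : probability (measurableTypeR R) R, is_linnik alpha c t L ->
     cond_law_cvg P (fun n w => Z n w (t_ n)) A L).
Proof.
move=> Z A.
have [alpha01 c0 d0 _ _] := SL; have /andP[alpha0 _] := alpha01.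
have b0 n : 0 < b n by case: hb.
(* Both facts concern only the generating functions, so a single one of the chains provides them for
   all [n]. *)
have k_le := killed_le (hZ1 0); have k_noninc := killed1_noninc (hZ1 0).
pose m n := Num.truncn (n%:R * t_ n).
pose f := gen_fun mu; pose g := gen_fun nu.
pose X n (w : T n) := Z n w (t_ n).
have t_ge0 : \forall n \near \oo, 0 <= t_ n.
  by move/cvgrPdist_lt/(_ _ t_gt0) : t_cvg; apply: filterS => n /ltr_normlW; lra.
have mt : (m n)%:R / n%:R @[n --> \oo] --> t.
  have low : t_ n - n%:R^-1 @[n --> \oo] --> t - 0.
    by apply: cvgB => //; rewrite -(@cvg_shiftS R (fun n => n%:R^-1)); exact: cvg_harmonic.
  rewrite subr0 in low; apply: (squeeze_cvgr _ low t_cvg); near=> n.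
  have n0 : 0 < n%:R :> R by rewrite ltr0n; near: n; exists 1%N.
  have tn : 0 <= t_ n by near: n.
  have /andP[m1 m2] := truncn_itv (mulr_ge0 (ltW n0) tn).
  apply/andP; split; last by rewrite ler_pdivrMr// mulrC.
  rewrite ler_pdivlMr// mulrBl mulVf ?lt0r_neq0// lerBlDr natr1 mulrC.
  exact: ltW.
have [M HM] := no_return_gt0 nu0 SL delta01 k_le k_noninc.
have mM : \forall n \near \oo, (M <= m n)%N.
  exact: (cvgny_ratio t_gt0 mt (nbhs_infty_ge M)).
have AE : \forall n \near \oo, A n = no_return (Z1 n) (m n).
  near=> n; have n0 : (0 < n)%N by near: n; exists 1%N.
  by apply: survival_event => //; near: n.
have PE n : P n (no_return (Z1 n) (m n)) = (killed f g (m n) 1)%:E.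
  exact: (probability_no_return (hZ1 n)).
have laplaceE lam n : 0 <= lam -> A n = no_return (Z1 n) (m n) ->
    cond_expect (P n) (exp_decay lam \o X n) (A n) =
    killed f g (m n) (expR (- (lam / b n))) / killed f g (m n) 1.
  move=> lam0 ->; rewrite /cond_expect PE; congr (_ / _).
  have s01 : 0 <= expR (- (lam / b n)) <= 1.
    by rewrite expR_ge0 -expR0 ler_expR oppr_le0 divr_ge0// ltW.
  rewrite /Rintegral -[RHS]/(fine (killed f g (m n) (expR (- (lam / b n))))%:E).
  rewrite -(integral_no_return (hZ1 n) (m n) s01); congr fine.
  apply: eq_integral => w _; congr EFin.
  rewrite /exp_decay/= /X /Z /scaled_path -/(m n) -expRM_natl; congr expR.
  by rewrite mulrN; congr (- _); field; rewrite lt0r_neq0.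
have lim_laplace lam : 0 <= lam ->
    cond_expect (P n) (exp_decay lam \o X n) (A n) @[n --> \oo] -->
    (1 + alpha * c * t * lam `^ alpha)^-1.
  rewrite le_eqVlt => /predU1P[<-|lam0].
    (* At [lam = 0] the quotient is 1 only where the conditioning event has positive probability,
       hence only eventually. *)
    rewrite powR0 ?lt0r_neq0// mulr0 addr0 invr1.
    apply: cvg_near_cst; near=> n; rewrite laplaceE//; last by near: n.
    rewrite mul0r oppr0 expR0 divff// lt0r_neq0// HM//.
    by near: n.
  apply: cvg_trans
    (conditional_laplace_cvg nu0 SL delta01 hb k_le k_noninc t_gt0 lam0 mt).
  by apply: near_eq_cvg; near=> n; rewrite laplaceE ?ltW//; near: n.
split => // L [L0 Llap] h ch [B hB].
apply: (@laplace_weak_cvg R (fun n h => cond_expect (P n) (h \o X n) (A n))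
  (fun h => (\int[L]_x h x)%R)).
- near=> n; have An : A n = no_return (Z1 n) (m n) by near: n.
  rewrite An; apply: cond_expect_mean.
  + exact: measurable_no_return.
  + by rewrite PE eqe lt0r_neq0// HM//; near: n.
  + apply: (@measurableT_comp _ _ _ _ _ _ (fun z : nat => z%:R / b n)) => //.
  + by move=> w _; rewrite /X /Z /scaled_path divr_ge0// ltW.
- exact: halfline_law_mean.
- by move=> lam lam0; rewrite (Llap lam lam0); exact: lim_laplace.
(* Continuity of the limiting transform at 0, which rules out a loss of mass at infinity. *)
- have H : (1 + alpha * c * t * lam `^ alpha)^-1 @[lam --> 0^'+] --> (1 + alpha * c * t * 0)^-1.
    apply: cvgV; first by rewrite mulr0 addr0 oner_neq0.
    apply: cvgD; first exact: cvg_cst.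
    by apply: cvgM; [exact: cvg_cst|exact: powR_cvg0].
  rewrite mulr0 addr0 invr1 in H; apply: cvg_trans H; apply: near_eq_cvg.
  near=> lam; rewrite -Llap// ltW//.
- by split => //; exists B => x _.
Unshelve. all: by end_near. Qed.
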